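(* If $\mathbf{B}$ and $\mathbf{B}'$ are homomorphically equivalent relational structures over a finite vocabulary (with finite universes), then $\mathsf{QCSP}^{\exists}(\mathbf{B})$ and $\mathsf{QCSP}^{\exists}(\mathbf{B}')$ uniformly reduce to each other.
   Context: A relational structure $\mathbf{A}$ over a vocabulary $\sigma$ (a set of relation symbols with arities) has a nonempty finite universe $A$ and a relation $R^{\mathbf{A}}\subseteq A^k$ for each symbol $R$ of arity $k$. A homomorphism $\mathbf{A}\to\mathbf{B}$ is a map $h:A\to B$ with $(h(a_1),\dots,h(a_k))\in R^{\mathbf{B}}$ whenever $(a_1,\dots,a_k)\in R^{\mathbf{A}}$; $\mathbf{A},\mathbf{B}$ are homomorphically equivalent if there are homomorphisms in both directions. $\mathsf{QCSP}^{\exists}(\mathbf{B})$ means $\mathsf{QCSP}^{\exists}(\Gamma)$ for the constraint language $\Gamma=\{R^{\mathbf{B}}\}$ over domain $B$. A quantified formula is $\exists X_1\forall Y_1\exists X_2\forall Y_2\cdots\exists X_t\,\mathcal{C}$ with pairwise disjoint variable blocks, all nonempty except possibly $X_1$, with all variables ranging over the domain. An extended constraint over $D$ is $(y_1=d_1)\wedge\cdots\wedge(y_m=d_m)\Rightarrow R(x_1,\dots,x_k)$ with $m\ge0$, $y_i$ universally quantified variables, $x_i$ existentially quantified variables, $d_i\in D$, $R\subseteq D^k$; it is true iff $R(x_1,\dots,x_k)$ holds or some $y_i\ne d_i$. $\mathsf{QCSP}^{\exists}(\Gamma)$ is the problem of deciding truth of quantified formulas whose $\mathcal{C}$ is a conjunction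 of extended constraints with relations from $\Gamma$. A uniform reduction is a polynomial-time many-one reduction that does not increase the number of nonempty quantifier blocks. *)

(* Defs.v *)
From HB Require Import structures.
From mathcomp Require Import all_boot.

Set Implicit Arguments.
Unset Strict Implicit.
Unset Printing Implicit Defensive.

(** * Relational structures *)

Record vocabulary := Vocabulary {
  symbol : finType;
  arity : symbol -> nat
}.

Record structure (sigma : vocabulary) := Structure {
  universe :> finType;
  universe_nonempty : 0 < #|universe|;
  interp : forall R : symbol sigma, {set (arity R).-tuple universe}
}.

Definition homomorphism (sigma : vocabulary) (A B : structure sigma)
    (h : A -> B) : Prop :=
  forall (R : symbol sigma) (a : (arity R).-tuple A),
    a \in interp A R -> [tuple of map h a] \in interp B R.

Definition hom_equivalent (sigma : vocabulary) (A B : structure sigma) : Prop :=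
  (exists h : A -> B, homomorphism h) /\ (exists h : B -> A, homomorphism h).

(** * Constraint languages *)

Definition relation (D : finType) : Type := {k : nat & {set k.-tuple D}}.
HB.instance Definition _ (D : finType) :=
  Choice.copy (relation D) {k : nat & ({set k.-tuple D} : choiceType)}.

(* A finite constraint language is the set of members of a list of relations;
   order and repetitions are irrelevant, as [seq_sub] only sees membership. *)
Definition language (D : finType) : Type := seq (relation D).

Definition language_of (sigma : vocabulary) (B : structure sigma) : language B :=
  [seq existT (fun k => {set k.-tuple B}) (arity R) (interp B R)
     | R <- enum (symbol sigma)].

(** * Quantified formulas with extended constraints *)

(* Variables are drawn from the countably infinite set of binary words. *)
Definition var : Type := seq bool.
HB.instance Definition _ := Countable.copy var (seq bool).

Section Formulas.
Variables (D : finType) (Gamma : language D).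

(* (y_1 = d_1) /\ ... /\ (y_m = d_m) => R (x_1, ..., x_k) *)
Record ext_constraint := ExtConstraint {
  premise : seq (var * D);
  crel : seq_sub Gamma;
  cargs : (tag (ssval crel)).-tuple var
}.

(* exists X_1 forall Y_1 exists X_2 ... forall Y_(t-1) exists X_t, C, with
   [alternations] listing the pairs (Y_i, X_(i+1)). *)
Record formula := Formula {
  first_block : seq var;
  alternations : seq (seq var * seq var);
  matrix : seq ext_constraint
}.

Definition blocks (phi : formula) : seq (seq var) :=
  first_block phi :: flatten [seq [:: YX.1; YX.2] | YX <- alternations phi].

Definition universal_vars (phi : formula) : seq var :=
  flatten [seq YX.1 | YX <- alternations phi].

Definition existential_vars (phi : formula) : seq var :=
  first_block phi ++ flatten [seq YX.2 | YX <- alternations phi].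

Definition well_formed (phi : formula) : bool :=
  [&& uniq (flatten (blocks phi)),
      all (fun X => X != [::]) (behead (blocks phi)) &
      all (fun c => all (fun yd => yd.1 \in universal_vars phi) (premise c)
                    && all (fun x => x \in existential_vars phi) (cargs c))
          (matrix phi)].

Definition holds_constraint (a : var -> D) (c : ext_constraint) : Prop :=
  (forall yd, yd \in premise c -> a yd.1 = yd.2) ->
  [tuple of map a (cargs c)] \in tagged (ssval (crel c)).

Definition holds_matrix (a : var -> D) (C : seq ext_constraint) : Prop :=
  foldr (fun c P => holds_constraint a c /\ P) True C.

Definition agree_off (X : seq var) (a a' : var -> D) : Prop :=
  forall v, v \notin X -> a' v = a v.

(* Quantifying a block of variables is quantifying over the assignments that
   differ from the current one only inside the block. *)
Fixpoint holds_from (s : seq (seq var * seq var)) (C : seq ext_constraint)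
    (a : var -> D) : Prop :=
  match s with
  | [::] => holds_matrix a C
  | (Y, X) :: s' =>
      forall a', agree_off Y a a' ->
      exists2 a'', agree_off X a' a'' & holds_from s' C a''
  end.

(* In a sentence the values of [a0] and [a] outside the first block are
   never used. *)
Definition true_formula (phi : formula) : Prop :=
  forall a0 : var -> D,
  exists2 a, agree_off (first_block phi) a0 a
           & holds_from (alternations phi) (matrix phi) a.

Record sentence := Sentence {
  sentence_val :> formula;
  sentence_wf : well_formed sentence_val
}.

Definition num_blocks (phi : formula) : nat :=
  count (fun X => X != [::]) (blocks phi).

End Formulas.

(** * Writing sentences as words *)

Inductive mark := MExists | MForall | MConstraint | MVar.

Definition mark_code (m : mark) : 'I_4 :=
  match m with
  | MExists => inord 0 | MForall => inord 1
  | MConstraint => inord 2 | MVar => inord 3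
  end.
Definition mark_decode (i : 'I_4) : mark :=
  match val i with
  | 0 => MExists | 1 => MForall | 2 => MConstraint | _ => MVar
  end.
Lemma mark_codeK : cancel mark_code mark_decode.
Proof. by case; rewrite /mark_decode /= inordK. Qed.
HB.instance Definition _ := Finite.copy mark (can_type mark_codeK).

(* The domain and the language are fixed parameters of the problem, so each
   element and each relation of the language is a single letter. *)
Definition letter (D : finType) (Gamma : language D) : finType :=
  (mark + bool + D + seq_sub Gamma)%type.

Section Encoding.
Variables (D : finType) (Gamma : language D).

Definition lmark (m : mark) : letter Gamma := inl (inl (inl m)).
Definition lbit (b : bool) : letter Gamma := inl (inl (inr b)).
Definition lelt (d : D) : letter Gamma := inl (inr d).
Definition lrel (r : seq_sub Gamma) : letter Gamma := inr r.

Definition encode_var (v : var) : seq (letter Gamma) :=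
  lmark MVar :: map lbit v.

Definition encode_vars (X : seq var) : seq (letter Gamma) :=
  flatten (map encode_var X).

Definition encode_constraint (c : ext_constraint Gamma) : seq (letter Gamma) :=
  lmark MConstraint
    :: flatten [seq rcons (encode_var yd.1) (lelt yd.2) | yd <- premise c]
    ++ lrel (crel c) :: encode_vars (cargs c).

Definition encode_formula (phi : formula Gamma) : seq (letter Gamma) :=
  (lmark MExists :: encode_vars (first_block phi))
  ++ flatten [seq (lmark MForall :: encode_vars YX.1)
                  ++ (lmark MExists :: encode_vars YX.2)
                | YX <- alternations phi]
  ++ flatten (map encode_constraint (matrix phi)).

End Encoding.

(** * Multi-tape Turing machines *)

Inductive direction := MoveLeft | Stay | MoveRight.

(* Tapes are infinite in both directions: (cells to the left of the head,
   nearest first; scanned cell; cells to the right), all other cells being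
   blank.  A blank cell is [None]. *)
Definition tape (S : Type) : Type := (seq (option S) * option S * seq (option S))%type.

Section Tapes.
Variable S : Type.

Definition blank_tape : tape S := ([::], None, [::]).

Definition tape_of_word (w : seq S) : tape S :=
  if w is x :: w' then ([::], Some x, map Some w') else blank_tape.

Definition scan (t : tape S) : option S := t.1.2.

Definition write (x : option S) (t : tape S) : tape S := (t.1.1, x, t.2).

Definition move (d : direction) (t : tape S) : tape S :=
  let: (l, x, r) := t in
  match d with
  | MoveLeft => (behead l, head None l, x :: r)
  | Stay => t
  | MoveRight => (x :: l, head None r, behead r)
  end.

Fixpoint nonblank_prefix (s : seq (option S)) : seq S :=
  if s is Some x :: s' then x :: nonblank_prefix s' else [::].

(* The word read from the head rightwards up to the first blank. *)
Definition word_of_tape (t : tape S) : seq S :=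
  nonblank_prefix (t.1.2 :: t.2).

End Tapes.

(* Deterministic machines from words over [A] to words over [B]: the first tape
   is the input tape, the last one is the output tape, and [None] as a
   transition means halting. *)
Record machine (A B : finType) := Machine {
  aux_tapes : nat;
  work : finType;
  state : finType;
  start : state;
  transition :
    state -> {ffun 'I_aux_tapes.+2 -> option (A + B + work)} ->
    option (state * {ffun 'I_aux_tapes.+2 ->
                      (option (A + B + work) * direction)})
}.

Section Runs.
Variables (A B : finType) (M : machine A B).

Definition tape_sym : Type := (A + B + work M)%type.
Definition in_sym (x : A) : tape_sym := inl (inl x).
Definition out_sym (y : B) : tape_sym := inl (inr y).

Definition config : Type :=
  (state M * ('I_(aux_tapes M).+2 -> tape tape_sym))%type.

Definition initial (w : seq A) : config :=
  (start M, fun i => if i == ord0 then tape_of_word (map in_sym w)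
                     else blank_tape tape_sym).

Definition step (c : config) : option config :=
  match transition c.1 [ffun i => scan (c.2 i)] with
  | None => None
  | Some (q, act) =>
      Some (q, fun i => move (act i).2 (write (act i).1 (c.2 i)))
  end.

(* [run n c] is the halting configuration reached from [c] in at most [n]
   steps, if there is one. *)
Fixpoint run (n : nat) (c : config) : option config :=
  match step c with
  | None => Some c
  | Some c' => if n is n'.+1 then run n' c' else None
  end.

Definition outputs_within (n : nat) (w : seq A) (u : seq B) : Prop :=
  exists2 c, run n (initial w) = Some c
           & word_of_tape (c.2 ord_max) = map out_sym u.

End Runs.

(** * Uniform reductions *)

(* A decision problem whose instances have a number of quantifier blocks. *)
Record problem := Problem {
  instance : Type;
  alphabet : finType;
  encode : instance -> seq alphabet;
  yes : instance -> Prop;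
  quantifier_blocks : instance -> nat
}.

Definition QCSPE (D : finType) (Gamma : language D) : problem := {|
  instance := sentence Gamma;
  alphabet := letter Gamma;
  encode := fun phi => encode_formula phi;
  yes := fun phi => true_formula phi;
  quantifier_blocks := fun phi => num_blocks phi
|}.

Definition QCSPE_structure (sigma : vocabulary) (B : structure sigma) : problem :=
  QCSPE (language_of B).

Definition polynomial_time (P Q : problem) (f : instance P -> instance Q) : Prop :=
  exists (M : machine (alphabet P) (alphabet Q)) (c k : nat),
  forall x : instance P,
    outputs_within M (c * size (encode x) ^ k + c) (encode x) (encode (f x)).

Definition uniformly_reduces (P Q : problem) : Prop :=
  exists f : instance P -> instance Q,
  [/\ polynomial_time f,
      forall x, yes x <-> yes (f x)
    & forall x, quantifier_blocks (f x) <= quantifier_blocks x].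

(* Main.v *)
From HB Require Import structures.
Require Import Defs.
From mathcomp Require Import all_boot zify.

Set Implicit Arguments.
Unset Strict Implicit.
Unset Printing Implicit Defensive.

(** Existential values are transported along the two homomorphisms.  Universal
    values cannot be, because a premise mentions elements of the domain; when
    the target has at least two elements, each variable is replaced by enough
    copies to write an element of the source domain as a tuple over the target,
    the unused tuples decoding to an arbitrary element.  When the target has
    only one element, a sentence over the source is false exactly when some
    constraint has a satisfiable premise and a relation whose translation is
    empty: if there is none, the first player wins by always playing the image
    of the one element.  So the sentence can be decided outright, and the answer
    expressed by a fixed sentence using no more blocks.

    Both reductions are computed by transducers with a read-only input tape and
    one auxiliary tape, which emit a whole word in one step. *)

(** * Transducers *)

(** With at least two target elements, [#|D|.+1] coordinates are ample because [2 ^ n] exceeds [n];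
    the number of copies depends on the source domain only, so the sentence grows by a constant
    factor. All blocks are copied alike, which preserves their emptiness or nonemptiness, but only
    copy 0 of an existential variable occurs in a constraint. With one target element no code
    exists. A nonempty target relation then consists of one constant tuple, and the homomorphism
    back sends it to a constant tuple of the source relation; hence a single source element serves
    all relations with nonempty translation at once. A premise is satisfiable iff its equations
    agree pairwise; testing this means comparing variable names of unbounded length, and that is
    what the auxiliary tape is for. *)

Definition zipper (A : Type) : Type := (seq A * seq A)%type.

(** A move off the left end, or to the right from the first blank, is undefined, so a zipper remains
    a word with a head position and has no blanks inside. *)
Definition zmove (A : Type) (d : direction) (z : zipper A) : option (zipper A) :=
  match d, z with
  | Stay, _ => Some z
  | MoveLeft, (x :: l, s) => Some (l, x :: s)
  | MoveRight, (l, x :: s) => Some (x :: l, s)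
  | _, _ => None
  end.

Definition zwrite (A : Type) (w : option A) (z : zipper A) : zipper A :=
  if w is Some x then (z.1, x :: behead z.2) else z.

Record action (Q : Type) (A B : Type) := Action {
  next : Q;
  dir_in : direction;
  aux_write : option A;
  dir_aux : direction;
  emit : seq B
}.

Record transducer (A B : finType) := Transducer {
  tstate : finType;
  tstart : tstate;
  tr : tstate -> option A -> option A -> option (action tstate A B)
}.

Arguments tr {A B} t.

Lemma outputs_within_le (A B : finType) (M : machine A B) m n w u :
  m <= n -> outputs_within M m w u -> outputs_within M n w u.
Proof.
move=> le_mn [c run_c ok_c]; exists c => //; move: run_c le_mn.
elim: m n (initial M w) => [|m IH] [|n] c0 //=; case: step => // c1 r /(IH _ _ r).
exact.
Qed.

Section Transducers.
Variables (A B : finType) (T : transducer A B).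

Record tconfig := TConfig {
  tcstate : tstate T;
  tcin : zipper A;
  tcaux : zipper A;
  tcout : seq B
}.

Definition taction (c : tconfig) : option (action (tstate T) A B) :=
  tr T (tcstate c) (ohead (tcin c).2) (ohead (tcaux c).2).

Definition tstep (c : tconfig) : option tconfig :=
  if taction c is Some a then
    if zmove (dir_in a) (tcin c) is Some zi then
      if zmove (dir_aux a) (zwrite (aux_write a) (tcaux c)) is Some za then
        Some (TConfig (next a) zi za (tcout c ++ emit a))
      else None
    else None
  else None.

(** The index only bounds the number of steps, so time estimates can be weakened and added without
    exact counts. *)
Inductive reach : nat -> tconfig -> tconfig -> Prop :=
| reach0 n c : reach n c c
| reachS n c c1 c2 : tstep c = Some c1 -> reach n c1 c2 -> reach n.+1 c c2.

Lemma reach_le m n c c' : m <= n -> reach m c c' -> reach n c c'.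
Proof.
move=> le_mn r; elim: r n le_mn => [m' c0|m' c0 c1 c2 s _ IH] [|n] //; try by constructor.
by rewrite ltnS => /IH; apply: reachS.
Qed.

Lemma reach_trans m n c1 c2 c3 :
  reach m c1 c2 -> reach n c2 c3 -> reach (m + n) c1 c3.
Proof.
move=> r; elim: r => [m' c|m' c c' c'' s _ IH] r'.
  by apply: reach_le r'; rewrite leq_addl.
by rewrite addSn; apply: (reachS s); apply: IH.
Qed.

Lemma reach1 c c' : tstep c = Some c' -> reach 1 c c'.
Proof. by move=> s; apply: (reachS s); constructor. Qed.

(** A transition depends on a state and two scanned letters only, so the maximum is over a finite
    type. It bounds the word that the compiled machine has to keep in its state. *)
Definition emit_bound : nat :=
  \max_(x : tstate T * option A * option A)
     if tr T x.1.1 x.1.2 x.2 is Some a then size (emit a) else 0.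

Lemma size_emit q x y a : tr T q x y = Some a -> size (emit a) <= emit_bound.
Proof.
move=> e.
have := @leq_bigmax _
  (fun x : tstate T * option A * option A =>
     if tr T x.1.1 x.1.2 x.2 is Some a then size (emit a) else 0) (q, x, y).
by rewrite /= e.
Qed.

Lemma size_reach n c c' :
  reach n c c' -> size (tcout c') <= size (tcout c) + n * emit_bound.
Proof.
elim=> [n' c0|n' c0 c1 c2 + _ IH]; first by rewrite leq_addr.
rewrite /tstep /taction; case e: (tr T) => [a|//].
case: zmove => [zi|//]; case: zmove => [za|//] [def1].
rewrite -{}def1 /= size_cat in IH; have := size_emit e; lia.
Qed.

(** * Compiling a transducer into a three-tape machine *)

Definition csym : Type := (A + B + void)%type.

Definition read_sym (x : option csym) : option A :=
  if x is Some (inl (inl a)) then Some a else None.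

(* [inl (q, s)]: in state [q] with [s] still to be written on the output tape;
   [inr false]: rewinding the output tape; [inr true]: halted. *)
Definition cstate : finType := ((tstate T * emit_bound.-bseq B) + bool)%type.

Definition ctape_in : 'I_3 := ord0.
Definition ctape_aux : 'I_3 := inord 1.

Definition cact (x : {ffun 'I_3 -> option csym}) (d0 : direction)
    (w1 : option csym) (d1 : direction) (w2 : option csym) (d2 : direction) :
    {ffun 'I_3 -> (option csym * direction)} :=
  [ffun i => if i == ctape_in then (x i, d0)
             else if i == ctape_aux then (w1, d1) else (w2, d2)].

Definition ctransition (q : cstate) (x : {ffun 'I_3 -> option csym}) :
    option (cstate * {ffun 'I_3 -> (option csym * direction)}) :=
  let x1 := x ctape_aux in
  let x2 := x ord_max in
  match q with
  | inl (q, s) =>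
    if bseqval s is y :: s' then
      Some (inl (q, insub_bseq _ s'),
            cact x Stay x1 Stay (Some (inl (inr y))) MoveRight)
    else if tr T q (read_sym (x ctape_in)) (read_sym x1) is Some a then
      Some (inl (next a, insub_bseq _ (emit a)),
            cact x (dir_in a)
              (if aux_write a is Some y then Some (inl (inl y)) else x1)
              (dir_aux a) x2 Stay)
    else Some (inr false, cact x Stay x1 Stay x2 MoveLeft)
  | inr false =>
    if x2 is Some _ then Some (inr false, cact x Stay x1 Stay x2 MoveLeft)
    else Some (inr true, cact x Stay x1 Stay x2 MoveRight)
  | inr true => None
  end.

Definition compile : machine A B :=
  @Machine A B 1 void cstate (inl (tstart T, insub_bseq _ [::])) ctransition.

Notation config := (config compile).

(** The [k] trailing blanks are needed because a head coming back from the end of the word leaves a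
    visited blank cell behind. *)
Definition represents (z : zipper A) (t : tape csym) : Prop :=
  exists k, t = ([seq Some (inl (inl x)) | x <- z.1],
                 omap (fun x => inl (inl x)) (ohead z.2),
                 [seq Some (inl (inl x)) | x <- behead z.2] ++ nseq k None).

Lemma represents_scan z t : represents z t -> read_sym (scan t) = ohead z.2.
Proof. by case=> k -> /=; case: z.2. Qed.

Lemma represents_write z t (w : option A) :
  represents z t ->
  represents (zwrite w z)
    (write (if w is Some y then Some (inl (inl y)) else scan t) t).
Proof. by case=> k ->; exists k; case: w. Qed.

Lemma represents_move z t d z' :
  represents z t -> zmove d z = Some z' -> represents z' (move d t).
Proof.
case: z => l s [k ->]; case: d => /=.
- case: l => [|x l] //= [<-]; case: s => [|y s] /=; last by exists k.
  by exists k.+1.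
- by case=> <-; exists k.
- case: s => [|x [|y s]] //= [<-] /=; last by exists k.
  by exists k.-1; case: k.
Qed.

Definition out_tape (o : seq B) : tape csym :=
  ([seq Some (inl (inr y)) | y <- rev o], None, [::]).

Definition simulates (s : seq B) (c : tconfig) (d : config) : Prop :=
  [/\ exists2 b : emit_bound.-bseq B, d.1 = inl (tcstate c, b) & bseqval b = s,
      represents (tcin c) (d.2 ctape_in),
      represents (tcaux c) (d.2 ctape_aux)
    & d.2 ord_max = out_tape (tcout c)].

Definition leads (k : nat) (d d' : config) : Prop :=
  forall n, run (k + n) d = run n d'.

Lemma leads_trans j k d1 d2 d3 :
  leads j d1 d2 -> leads k d2 d3 -> leads (j + k) d1 d3.
Proof. by move=> h1 h2 n; rewrite -addnA h1 h2. Qed.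

Lemma leads1 d d' : step d = Some d' -> leads 1 d d'.
Proof. by move=> s n; rewrite add1n /= s. Qed.

Lemma ctape_auxE : (ctape_aux == ctape_in) = false.
Proof. by apply/eqP => /(congr1 val); rewrite /= inordK. Qed.

Lemma ctape_outE :
  ((ord_max : 'I_3) == ctape_in) = false /\ ((ord_max : 'I_3) == ctape_aux) = false.
Proof.
by split=> //; apply/eqP => /(congr1 val); rewrite /= inordK.
Qed.

Definition cactE := (ffunE, eqxx, ctape_auxE, ctape_outE.1, ctape_outE.2).

Lemma flush s c d :
  simulates s c d ->
  exists2 d', leads (size s) d d'
    & simulates [::] (TConfig (tcstate c) (tcin c) (tcaux c) (tcout c ++ s)) d'.
Proof.
elim: s c d => [|y s IH] c d.
  by exists d; rewrite ?cats0 //; case: c H.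
case: d => dq dt [[b /= eq eb] r0 r1 r2].
(* The tail of a pending word still fits the bound, so [insub_bseq] stores it unchanged. *)
have lt_s : size s <= emit_bound by have := size_bseq b; rewrite eb; apply: ltnW.
pose c1 := TConfig (tcstate c) (tcin c) (tcaux c) (rcons (tcout c) y).
have [|d2 h2 s2] := IH c1 (inl (tcstate c, insub_bseq _ s),
   fun i => move (cact [ffun i => scan (dt i)] Stay (scan (dt ctape_aux)) Stay
     (Some (inl (inr y))) MoveRight i).2
     (write (cact [ffun i => scan (dt i)] Stay (scan (dt ctape_aux)) Stay
     (Some (inl (inr y))) MoveRight i).1 (dt i))).
  split; rewrite /= ?cactE //=.
  - exists (insub_bseq _ s) => //; exact: insubdK.
  - by case: r0 => k ->; exists k.
  - by case: r1 => k ->; exists k.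
  - by rewrite r2 /out_tape rev_rcons.
exists d2; last by rewrite /c1 /= cat_rcons in s2.
rewrite -add1n; apply: leads_trans h2; apply: leads1.
by rewrite /step /= eq /= eb /= cactE.
Qed.

Lemma simulate_step c c' d :
  tstep c = Some c' -> simulates [::] c d ->
  exists k, exists2 d', leads k d d' & k <= emit_bound.+1 /\ simulates [::] c' d'.
Proof.
case: d => dq dt; rewrite /tstep; case ea: taction => [a|//].
case ei: zmove => [zi|//]; case ex: zmove => [za|//] [<-{c'}].
case=> -[b /= eq eb] r0 r1 r2.
have le_a := size_emit ea.
have := @flush (emit a) (TConfig (next a) zi za (tcout c))
   (inl (next a, insub_bseq _ (emit a)),
     fun i => let x := cact [ffun i => scan (dt i)] (dir_in a)
                (if aux_write a is Some y then Some (inl (inl y)) else scan (dt ctape_aux))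
                (dir_aux a) (scan (dt ord_max)) Stay i in
        move x.2 (write x.1 (dt i))).
case.
  split; rewrite /= ?cactE //=.
  - by exists (insub_bseq _ (emit a)) => //; apply: insubdK.
  - exact: (represents_move (represents_write None r0) ei).
  - exact: (represents_move (represents_write (aux_write a) r1) ex).
  - by rewrite r2.
move=> d2 h2 s2; exists (size (emit a)).+1; exists d2; last by [].
rewrite -add1n; apply: leads_trans h2; apply: leads1.
rewrite /step /= eq /= eb /= !cactE (represents_scan r0) (represents_scan r1).
by move: ea; rewrite /taction => ->.
Qed.

Lemma simulate n c c' d :
  reach n c c' -> simulates [::] c d ->
  exists k, exists2 d', leads k d d' & k <= n * emit_bound.+1 /\ simulates [::] c' d'.
Proof.
move=> r; elim: r d => [n' c0|n' c0 c1 c2 s _ IH] d sd.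
  by exists 0, d.
have [k [d1 h1 [le1 s1]]] := simulate_step s sd.
have [k2 [d2 h2 [le2 s2]]] := IH _ s1.
exists (k + k2), d2; first exact: leads_trans h1 h2.
split=> //; rewrite mulSn; lia.
Qed.

(** [o] is the output from the head leftwards, nearest letter first, and [r] the part already
    passed. The last [None] is the blank on which writing stopped; it ends the word that is read
    off. *)
Lemma rewind (o r : seq B) d :
  d.1 = inr false ->
  d.2 ord_max = ([seq Some (inl (inr y)) | y <- behead o],
                 omap (fun y => inl (inr y)) (ohead o),
                 rcons [seq Some (inl (inr y)) | y <- r] None) ->
  exists2 d', leads (size o).+1 d d'
    & d'.1 = inr true /\
      word_of_tape (d'.2 ord_max) = map (@out_sym _ _ compile) (catrev o r).
Proof.
elim: o r d => [|y o IH] r [dq dt] /= -> ed.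
  eexists; first by apply: leads1; rewrite /step /= cactE ed /=; reflexivity.
  split=> //=; rewrite !cactE /= ed /=.
  have e (s : seq B) : nonblank_prefix (rcons [seq Some (inl (inr y)) | y <- s] None)
      = map (@out_sym _ _ compile) s by elim: s => //= x s ->.
  by case: r {ed} => //= x r; rewrite -e.
rewrite /=.
have [|d2 h2 [q2 w2]] := IH (y :: r) (inr false,
     fun i => let x := cact [ffun i => scan (dt i)] Stay (scan (dt ctape_aux))
                Stay (scan (dt ord_max)) MoveLeft i in
        move x.2 (write x.1 (dt i))) erefl.
  by rewrite /= !cactE /= ed; case: o {IH ed} => [|z o].
exists d2; last by [].
rewrite -add1n; apply: leads_trans h2; apply: leads1.
by rewrite /step /= !cactE ed.
Qed.

(** With [E] the emission bound, simulation takes at most [n * (E + 1)] steps, the turn one, and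
    rewinding [size o + 1 <= n * E + 1]; the sum is the stated bound. *)
Lemma compile_correct n w l s z o q :
  reach n (TConfig (tstart T) ([::], w) ([::], [::]) [::]) (TConfig q (l, s) z o) ->
  tr T q (ohead s) (ohead z.2) = None ->
  outputs_within compile (n * (emit_bound.*2.+1) + 2) w o.
Proof.
move=> r halt.
have s0 : simulates [::] (TConfig (tstart T) ([::], w) ([::], [::]) [::])
            (initial compile w).
  split=> //=; rewrite ?ctape_auxE.
  - by exists (insub_bseq _ [::]) => //; apply: insubdK.
  - by exists 0; rewrite cats0; case: w {r} => //= x w; rewrite -map_comp.
  - by exists 0.
have [k [[dq dt] h1 [le1 [[b /= eq eb] r0 r1 r2]]]] := simulate r s0.
have := size_reach r; rewrite /= add0n => le_o.
pose d1 : config := (inr false,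
     fun i => let x := cact [ffun i => scan (dt i)] Stay (scan (dt ctape_aux))
                Stay (scan (dt ord_max)) MoveLeft i in
        move x.2 (write x.1 (dt i))).
have h2 : leads 1 (dq, dt) d1.
  apply: leads1; rewrite /step /= eq /= eb !cactE.
  by rewrite (represents_scan r0) (represents_scan r1) halt.
have [||d3 h3 [q3 w3]] := @rewind (rev o) [::] d1 => //.
  by rewrite /d1 /= !cactE /= r2 /out_tape; case: (rev o).
exists d3; last by rewrite w3 /rev catrevE revK cats0.
have -> : n * emit_bound.*2.+1 + 2
        = (k + 1 + (size (rev o)).+1)
          + (n * emit_bound.*2.+1 + 2 - (k + 1 + (size (rev o)).+1)).
  rewrite size_rev subnKC //; rewrite -muln2 in le1 le_o *; nia.
rewrite (leads_trans (leads_trans h1 h2) h3).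
by case: (_ - _) => [|j]; rewrite /= /step q3.
Qed.

End Transducers.

(** * Games *)

(** Membership is phrased on sequences because the arities of a relation and of its translation are
    only provably equal; tuples would have to be cast. *)
Definition in_rel (D : finType) (r : relation D) (s : seq D) : bool :=
  [exists t : (tag r).-tuple D, (t \in tagged r) && (val t == s)].

Lemma in_relE (D : finType) (r : relation D) (t : (tag r).-tuple D) :
  in_rel r t = (t \in tagged r).
Proof.
apply/existsP/idP => [[u /andP[ur /eqP/val_inj <-]]//|tr].
by exists t; rewrite tr eqxx.
Qed.

Lemma holds_constraintE (D : finType) (Gamma : language D) (a : var -> D)
    (c : ext_constraint Gamma) :
  holds_constraint a c <->
  ((forall yd, yd \in premise c -> a yd.1 = yd.2) ->
   in_rel (ssval (crel c)) (map a (cargs c))).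
Proof. by rewrite -[map a _]/(val [tuple of map a (cargs c)]) in_relE. Qed.

Definition map_blocks (f : seq var -> seq var) (s : seq (seq var * seq var)) :=
  [seq (f YX.1, f YX.2) | YX <- s].

Lemma map_blocks_id s : map_blocks id s = s.
Proof. by elim: s => //= -[Y X] s ->. Qed.

Section Transfer.
Variables (D1 D2 : finType) (G1 : language D1) (G2 : language D2).
Variables (f1 f2 : seq var -> seq var) (U : pred var).
Variable inv : seq var -> (var -> D1) -> (var -> D2) -> Prop.

Hypothesis universal_move : forall E Y a1 a2 b2,
  {subset Y <= U} -> inv E a1 a2 -> agree_off (f2 Y) a2 b2 ->
  exists2 b1, agree_off (f1 Y) a1 b1 & inv E b1 b2.
Hypothesis existential_move : forall E X a1 a2 b1,
  {in X, forall x, ~~ U x} -> inv E a1 a2 -> agree_off (f1 X) a1 b1 ->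
  exists2 b2, agree_off (f2 X) a2 b2 & inv (E ++ X) b1 b2.

(** Strategy copying: each universal move of the second game is pulled back to the first, and the
    winning answer there is pushed forward. [E] lists the existential variables already played. It
    is used in both directions, with the identity as one of [f1], [f2]. *)
Lemma holds_from_transfer s (C1 : seq (ext_constraint G1))
    (C2 : seq (ext_constraint G2)) E a1 a2 :
  {in flatten [seq YX.1 | YX <- s], forall y, U y} ->
  {in flatten [seq YX.2 | YX <- s], forall x, ~~ U x} ->
  (forall a1 a2, inv (E ++ flatten [seq YX.2 | YX <- s]) a1 a2 ->
     holds_matrix a1 C1 -> holds_matrix a2 C2) ->
  inv E a1 a2 ->
  holds_from (map_blocks f1 s) C1 a1 -> holds_from (map_blocks f2 s) C2 a2.
Proof.
elim: s E a1 a2 => [|[Y X] s IH] E a1 a2 /= sY sX hC i12.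
  by apply: hC; rewrite ?cats0.
move=> h1 b2 ab2.
have [|b1 ab1 ib] := universal_move _ i12 ab2.
  by move=> y yY; apply: sY; rewrite mem_cat yY.
have [c1 bc1 hc1] := h1 b1 ab1.
have [|c2 bc2 ic] := existential_move _ ib bc1.
  by move=> x xX; apply: sX; rewrite mem_cat xX.
exists c2 => //; apply: (IH (E ++ X) c1) => //.
- by move=> y ys; apply: sY; rewrite mem_cat ys orbT.
- by move=> x xs; apply: sX; rewrite mem_cat xs orbT.
- by rewrite -catA.
Qed.

End Transfer.

Section WellFormed.
Variables (D : finType) (G : language D) (phi : formula G).
Lemma perm_blocks :
  perm_eq (flatten (blocks phi)) (existential_vars phi ++ universal_vars phi).
Proof.
apply/permP => p; rewrite /blocks /existential_vars /universal_vars /=.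
rewrite !count_cat -addnA; congr (_ + _).
elim: (alternations phi) => //= -[Y X] s IH; rewrite !count_cat IH /=; lia.
Qed.

Hypothesis wf : well_formed phi.

Lemma existential_not_universal x :
  x \in existential_vars phi -> x \notin universal_vars phi.
Proof.
case/and3P: wf; rewrite (perm_uniq perm_blocks) cat_uniq => /and3P[_ + _] _ _.
by move=> /hasPn nU xE; apply/negP => /nU /=; rewrite xE.
Qed.

Lemma universal_block :
  {in flatten [seq YX.1 | YX <- alternations phi],
      forall y, [pred v | v \in universal_vars phi] y}.
Proof. by []. Qed.

Lemma existential_block :
  {in flatten [seq YX.2 | YX <- alternations phi],
      forall x, ~~ [pred v | v \in universal_vars phi] x}.
Proof.
by move=> x xs; apply: existential_not_universal; rewrite mem_cat xs orbT.
Qed.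

Lemma first_not_universal :
  {in first_block phi, forall x, ~~ [pred v | v \in universal_vars phi] x}.
Proof. by move=> x xs; apply: existential_not_universal; rewrite mem_cat xs. Qed.

End WellFormed.

(** * Splitting variables *)

(** The index is written in unary and closed by [false], so it can be read off any word; a
    transducer writes this prefix and then copies the bits of [v] verbatim. *)
Definition name (i : nat) (v : var) : var := nseq i true ++ false :: v.

Definition unname (w : var) : nat * var :=
  let i := find negb w in (i, drop i.+1 w).

Lemma nameK i v : unname (name i v) = (i, v).
Proof.
rewrite /unname /name; have -> : find negb (nseq i true ++ false :: v) = i.
  by elim: i => //= i ->.
by congr pair; elim: i => [|i IH] //=; rewrite drop0.
Qed.

Lemma name_inj i j v w : name i v = name j w -> i = j /\ v = w.
Proof. by move=> /(congr1 unname); rewrite !nameK => -[]. Qed.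

(** Descending order suits a counter kept in the state: copying always ends at index 0, and a
    variable to be copied only once simply starts there. *)
Fixpoint countdown (n : nat) : seq nat :=
  if n is n'.+1 then n :: countdown n' else [:: 0].

Lemma mem_countdown n i : (i \in countdown n) = (i <= n).
Proof.
by elim: n => [|n IH] /=; rewrite inE ?IH ?leqn0 // [RHS]leq_eqVlt ltnS.
Qed.

Lemma countdown_uniq n : uniq (countdown n).
Proof. by elim: n => //= n ->; rewrite mem_countdown ltnn. Qed.

Section Copies.
Variable M : nat.

Definition copies (X : seq var) : seq var :=
  [seq name i v | v <- X, i <- countdown M].

Lemma copies_cat X Y : copies (X ++ Y) = copies X ++ copies Y.
Proof. by rewrite /copies map_cat flatten_cat. Qed.

Lemma copies_flatten S : copies (flatten S) = flatten (map copies S).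
Proof. by elim: S => //= X S IH; rewrite copies_cat IH. Qed.

Lemma mem_copies i v X : (name i v \in copies X) = (v \in X) && (i <= M).
Proof.
apply/allpairsP/andP => [[[w j] /= [wX jM /name_inj[-> ->]]]|[vX iM]].
  by rewrite -mem_countdown.
by exists (v, i); rewrite mem_countdown.
Qed.

Lemma copies_uniq X : uniq X -> uniq (copies X).
Proof.
move=> uX; apply: allpairs_uniq => //; first exact: countdown_uniq.
by move=> [v i] [w j] _ _ /name_inj[/= -> ->].
Qed.

Lemma copies_eq0 X : (copies X == [::]) = (X == [::]).
Proof. by case: X => [|v X] //; rewrite /copies /=; case: M. Qed.

End Copies.

Section Splitting.
Variables (D D' : finType) (G : language D) (G' : language D').
Variable trel : seq_sub G -> seq_sub G'.
Hypothesis tag_trel : forall r, tag (ssval (trel r)) = tag (ssval r).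
Variables (M : nat) (e : nat -> D -> D').

Lemma split_args_size (c : ext_constraint G) :
  size (map (name 0) (cargs c)) == tag (ssval (trel (crel c))).
Proof. by rewrite size_map size_tuple tag_trel. Qed.

Definition split_constraint (c : ext_constraint G) : ext_constraint G' :=
  ExtConstraint
    [seq (name i yd.1, e i yd.2) | yd <- premise c, i <- countdown M]
    (Tuple (split_args_size c)).

Definition split_formula (phi : formula G) : formula G' :=
  Formula (copies M (first_block phi))
    (map_blocks (copies M) (alternations phi))
    (map split_constraint (matrix phi)).

Lemma split_blocks phi : blocks (split_formula phi) = map (copies M) (blocks phi).
Proof.
by rewrite /blocks /=; congr (_ :: _); elim: (alternations phi) => //= YX s ->.
Qed.

Lemma split_universal phi :
  universal_vars (split_formula phi) = copies M (universal_vars phi).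
Proof.
by rewrite /universal_vars copies_flatten /= /map_blocks -!map_comp.
Qed.

Lemma split_existential phi :
  existential_vars (split_formula phi) = copies M (existential_vars phi).
Proof.
by rewrite /existential_vars copies_cat copies_flatten /= /map_blocks -!map_comp.
Qed.

Lemma split_wf phi : well_formed phi -> well_formed (split_formula phi).
Proof.
case/and3P=> u ne mx; apply/and3P; split.
- by rewrite split_blocks -copies_flatten copies_uniq.
- rewrite split_blocks behead_map all_map.
  by apply: sub_all ne => X; rewrite /= copies_eq0.
rewrite all_map; apply: sub_all mx => c /andP[/allP pc /allP ac] /=.
rewrite split_universal split_existential; apply/andP; split; apply/allP.
  by move=> _ /allpairsP[[yd i] /= [/pc yU iM ->]]; rewrite mem_copies yU -mem_countdown.
by move=> _ /mapP[x /ac xE ->]; rewrite mem_copies xE.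
Qed.

Definition split_sentence (phi : sentence G) : sentence G' :=
  Sentence (split_wf (sentence_wf phi)).

Lemma num_blocks_split phi : num_blocks (split_formula phi) = num_blocks phi.
Proof.
rewrite /num_blocks split_blocks count_map; apply: eq_count => X /=.
by rewrite copies_eq0.
Qed.

Variables (h : D -> D') (h' : D' -> D).
Hypothesis hom_h : forall r s, in_rel (ssval r) s -> in_rel (ssval (trel r)) (map h s).
Hypothesis hom_h' : forall r s, in_rel (ssval (trel r)) s -> in_rel (ssval r) (map h' s).
Hypothesis e_inj : forall d d', (forall i, i <= M -> e i d = e i d') -> d = d'.

Section Truth.
Variable phi : formula G.
Hypothesis wf : well_formed phi.
Let U : pred var := [pred v | v \in universal_vars phi].
Let Ex : seq var := first_block phi ++ flatten [seq YX.2 | YX <- alternations phi].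

(** Universal variables are constrained only when their copies spell a code word, since the
    universal player of the target may choose any tuple. The first clause covers universal variables
    not yet played as well; [~~ U v] guarantees that later universal blocks leave the values on [E]
    alone. *)
Definition decoded (E : seq var) (a : var -> D) (a' : var -> D') : Prop :=
  (forall v d, U v -> (forall i, i <= M -> a' (name i v) = e i d) -> a v = d) /\
  {in E, forall v, ~~ U v /\ a' (name 0 v) = h (a v)}.

(** In this direction the universal moves come from the source, so the copies always carry an exact
    code word. *)
Definition encoded (E : seq var) (a' : var -> D') (a : var -> D) : Prop :=
  (forall v i, U v -> i <= M -> a' (name i v) = e i (a v)) /\
  {in E, forall v, ~~ U v /\ a v = h' (a' (name 0 v))}.

Lemma decoded_matrix a a' :
  decoded Ex a a' -> holds_matrix a (matrix phi) ->
  holds_matrix a' (matrix (split_formula phi)).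
Proof.
case=> dU dE; have /and3P[_ _] := wf; rewrite /holds_matrix /=.
elim: (matrix phi) => //= c C IH /andP[/andP[/allP pc /allP ac] wC] [hc hC].
split; last exact: IH.
apply/holds_constraintE => /= hp; rewrite -map_comp.
have -> : [seq (a' \o name 0) i | i <- cargs c] = map h (map a (cargs c)).
  by rewrite -map_comp; apply/eq_in_map => x /ac /dE[_ /= ->].
apply: hom_h; move/holds_constraintE: hc; apply => yd ydp.
apply: dU => [|i iM]; first exact: pc.
apply: (hp (name i yd.1, e i yd.2)); apply/allpairsP; exists (yd, i).
by rewrite mem_countdown.
Qed.

Lemma encoded_matrix a a' :
  encoded Ex a' a -> holds_matrix a' (matrix (split_formula phi)) ->
  holds_matrix a (matrix phi).
Proof.
case=> dU dE; have /and3P[_ _] := wf; rewrite /holds_matrix /=.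
elim: (matrix phi) => //= c C IH /andP[/andP[/allP pc /allP ac] wC] [hc hC].
split; last exact: IH.
apply/holds_constraintE => hp.
have -> : map a (cargs c) = map h' (map a' (map (name 0) (cargs c))).
  by rewrite -!map_comp; apply/eq_in_map => x /ac /dE[_ /= ->].
apply: hom_h'; move/holds_constraintE: hc; apply => _ /allpairsP[[yd i] /= [ydp iM ->]] /=.
by rewrite dU ?hp -?mem_countdown //; exact: pc.
Qed.

Definition decode_var (b' : var -> D') (v : var) (d0 : D) : D :=
  odflt d0 [pick d | [forall i : 'I_M.+1, b' (name i v) == e i d]].

Lemma decode_varE b' v d d0 :
  (forall i, i <= M -> b' (name i v) = e i d) -> decode_var b' v d0 = d.
Proof.
move=> bE; rewrite /decode_var; case: pickP => [d1 /forallP H|/(_ d)/negP[]].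
  apply: e_inj => i iM; rewrite -bE //.
  by have /eqP := H (Ordinal (iM : i < M.+1)).
by apply/forallP => i; rewrite bE // -ltnS.
Qed.

Lemma decoded_universal E Y a a' b' :
  {subset Y <= U} -> decoded E a a' -> agree_off (copies M Y) a' b' ->
  exists2 b, agree_off Y a b & decoded E b b'.
Proof.
move=> YU [dU dE] ab.
exists (fun v => if v \in Y then decode_var b' v (a v) else a v).
  by move=> v /negPf ->.
split=> [v d Uv bE|v vE].
  case: ifPn => vY; first exact: decode_varE.
  by apply: dU => // i iM; rewrite -ab ?bE // mem_copies (negPf vY).
have [nU av] := dE v vE; have vY : v \notin Y by apply: contra nU => /YU.
by rewrite (negPf vY) ab ?av // mem_copies (negPf vY).
Qed.

Lemma decoded_existential E X a a' b :
  {in X, forall x, ~~ U x} -> decoded E a a' -> agree_off X a b ->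
  exists2 b', agree_off (copies M X) a' b' & decoded (E ++ X) b b'.
Proof.
move=> XU [dU dE] ab.
exists (fun w => if w \in copies M X then h (b (unname w).2) else a' w).
  by move=> v /negPf ->.
split=> [v d Uv bE|v].
  have vX : v \notin X by apply/negP => /XU /negP.
  rewrite ab //; apply: dU => // i iM; rewrite -bE // mem_copies (negPf vX) //.
rewrite mem_copies andbT nameK /= mem_cat.
case: ifPn => [vX|vX]; first by rewrite orbT => _; split=> //; apply: XU.
by rewrite orbF => /dE[nU ->]; rewrite ab.
Qed.

Lemma encoded_universal E Y a' a b :
  {subset Y <= U} -> encoded E a' a -> agree_off Y a b ->
  exists2 b', agree_off (copies M Y) a' b' & encoded E b' b.
Proof.
move=> YU [dU dE] ab.
exists (fun w => if w \in copies M Y then e (unname w).1 (b (unname w).2) else a' w).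
  by move=> v /negPf ->.
split=> [v i Uv iM|v vE].
  rewrite mem_copies iM andbT nameK; case: ifPn => //= vY.
  by rewrite dU // ab.
have [nU av] := dE v vE; have vY : v \notin Y by apply: contra nU => /YU.
by rewrite mem_copies (negPf vY) ab // -av.
Qed.

Lemma encoded_existential E X a' a b' :
  {in X, forall x, ~~ U x} -> encoded E a' a -> agree_off (copies M X) a' b' ->
  exists2 b, agree_off X a b & encoded (E ++ X) b' b.
Proof.
move=> XU [dU dE] ab.
exists (fun v => if v \in X then h' (b' (name 0 v)) else a v).
  by move=> v /negPf ->.
split=> [v i Uv iM|v].
  have vX : v \notin X by apply/negP => /XU /negP.
  by rewrite (negPf vX) -dU // ab // mem_copies (negPf vX).
rewrite mem_cat.
case: ifPn => [vX|vX]; first by rewrite orbT => _; split=> //; apply: XU.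
by rewrite orbF => /dE[nU ->]; rewrite ab // mem_copies (negPf vX).
Qed.

Lemma split_true : true_formula phi <-> true_formula (split_formula phi).
Proof.
split=> H.
  move=> a'; have [a ha] : exists a, decoded [::] a a'.
    (* [h' (a' v)] is merely some element of [D], the default for tuples that encode nothing. *)
    exists (fun v => decode_var a' v (h' (a' v))).
    by split=> // v d _; apply: decode_varE.
  have [b ab hb] := H a.
  have [b' ab' hb'] := decoded_existential (first_not_universal wf) ha ab.
  exists b' => //; rewrite -[alternations phi]map_blocks_id in hb.
  apply: (holds_from_transfer decoded_universal decoded_existential _ _ _ hb') hb.
  - exact: universal_block.
  - exact: existential_block wf.
  - exact: decoded_matrix.
move=> a; have [a' ha] : exists a', encoded [::] a' a.
  by exists (fun w => e (unname w).1 (a (unname w).2)); split=> // v i _ _; rewrite nameK.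
have [b' ab' hb'] := H a'.
have [b ab hb] := encoded_existential (first_not_universal wf) ha ab'.
exists b => //; rewrite -[alternations phi]map_blocks_id.
apply: (holds_from_transfer encoded_universal encoded_existential _ _ _ hb) hb'.
- exact: universal_block.
- exact: existential_block wf.
- by move=> a1 a2; apply: encoded_matrix.
Qed.

End Truth.
End Splitting.

(** * Computing the split sentence in linear time *)

Lemma flatten_allpairs (S I T W : Type) (k : T -> seq W) (g : S -> I -> T) s t :
  flatten (map k [seq g x i | x <- s, i <- t])
  = flatten [seq flatten [seq k (g x i) | i <- t] | x <- s].
Proof.
by elim: s => //= x s IH; rewrite map_cat flatten_cat IH -map_comp.
Qed.

Section SplitTransducer.
Variables (D D' : finType) (G : language D) (G' : language D').
Variable trel : seq_sub G -> seq_sub G'.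
Hypothesis tag_trel : forall r, tag (ssval (trel r)) = tag (ssval r).
Variables (M : nat) (e : nat -> D -> D').

Let A := letter G.
Let B := letter G'.

(* [(b, None)]: about to read a new item; [b] tells whether variables are to be
   copied [M.+1] times or only once.
   [(b, Some (false, i))]: writing the bits of the [i]-th copy.
   [(b, Some (true, i))]: going back to the start of the variable, to write its
   [i]-th copy. *)
Definition split_state : finType := (bool * option (bool * 'I_M.+1))%type.

Definition name_prefix (i : nat) : seq B := encode_var G' (rcons (nseq i true) false).

Definition split_act (q : split_state) (d : direction) (o : seq B) :=
  Some (Action q d (None : option A) Stay o).

Definition split_tr (q : split_state) (x y : option A) :
    option (action split_state A B) :=
  match q with
  | (b, None) =>
    match x with
    | Some (inl (inl (inl m))) =>
      match m with
      | MVar => let i := if b then ord_max else ord0 in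
                split_act (b, Some (false, i)) MoveRight (name_prefix i)
      | MConstraint => split_act (true, None) MoveRight [:: lmark G' m]
      | _ => split_act (b, None) MoveRight [:: lmark G' m]
      end
    | Some (inr r) => split_act (false, None) MoveRight [:: lrel (trel r)]
    | _ => None
    end
  | (b, Some (false, i)) =>
    match x with
    | Some (inl (inl (inr c))) => split_act q MoveRight [:: lbit G' c]
    | Some (inl (inr d)) =>
      if i == 0 :> nat then split_act (b, None) MoveRight [:: lelt G' (e i d)]
      else split_act (b, Some (true, inord i.-1)) MoveLeft [:: lelt G' (e i d)]
    | _ =>
      if i == 0 :> nat then split_act (b, None) Stay [::]
      else split_act (b, Some (true, inord i.-1)) MoveLeft [::]
    end
  | (b, Some (true, i)) =>
    if x is Some (inl (inl (inl MVar))) then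
      split_act (b, Some (false, i)) MoveRight (name_prefix i)
    else split_act q MoveLeft [::]
  end.

Definition split_transducer : transducer A B :=
  @Transducer A B split_state (true, None) split_tr.

Let T := split_transducer.
Notation reach := (@reach _ _ T).
Notation cfg q z o := (@TConfig _ _ T q z ([::], [::]) o).
Notation bits := (map (lbit G)).

(** A variable has no end mark: its end is recognised by the next letter, which must be neither a
    bit nor an element. *)
Definition ended (s : seq A) : bool :=
  match s with
  | inl (inl (inr _)) :: _ | inl (inr _) :: _ => false
  | _ => true
  end.

Lemma copy_bits b i v l s o :
  reach (size v) (cfg (b, Some (false, i)) (l, bits v ++ s) o)
    (cfg (b, Some (false, i)) (rev (bits v) ++ l, s) (o ++ map (lbit G') v)).
Proof.
elim: v l o => [|c v IH] l o; first by rewrite cats0; constructor.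
apply: reachS; first by reflexivity.
by have := IH (lbit G c :: l) (o ++ [:: lbit G' c]); rewrite /= rev_cons cat_rcons -catA.
Qed.

(** The start is given through [zmove] because the cell left of [s] is the last bit of [v] or, for
    an empty [v], the mark itself. *)
Lemma go_back b i (v : var) l s z o :
  zmove MoveLeft (rev (bits v) ++ lmark G MVar :: l, s) = Some z ->
  reach (size v) (cfg (b, Some (true, i)) z o)
    (cfg (b, Some (true, i)) (l, lmark G MVar :: bits v ++ s) o).
Proof.
elim/last_ind: v s z => [|v c IH] s z; first by move=> /= [<-]; constructor.
rewrite map_rcons rev_rcons /= => -[<-]; rewrite size_rcons.
have [z' ez] : exists z',
    zmove MoveLeft (rev (bits v) ++ lmark G MVar :: l, lbit G c :: s) = Some z'.
  by case: (rev _) => [|x l'] /=; eexists.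
apply: (@reachS _ _ T _ _ (cfg (b, Some (true, i)) z' o)).
  by rewrite /tstep /= in ez *; rewrite ez cats0.
by rewrite cat_rcons; apply: IH.
Qed.

Definition elt_in (d : option D) : seq A := oapp (fun d => [:: lelt G d]) [::] d.
Definition elt_out (i : nat) (d : option D) : seq B :=
  oapp (fun d => [:: lelt G' (e i d)]) [::] d.

Lemma encode_name i v : encode_var G' (name i v) = name_prefix i ++ map (lbit G') v.
Proof. by rewrite /encode_var /name -cat_rcons map_cat. Qed.

(** [c0] is left open because the first copy is begun from the reading state and the later ones from
    the going-back state. Each copy costs one pass over [v] and at most one pass back. *)
Lemma copy_var b i v d l s o c0 :
  i <= M -> (d = None -> ended s) ->
  tstep c0 = Some (cfg (b, Some (false, inord i))
     (lmark G MVar :: l, bits v ++ elt_in d ++ s) (o ++ name_prefix i)) ->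
  reach (i.+1 * (size v).+1.*2) c0
    (cfg (b, None) (rev (elt_in d) ++ rev (bits v) ++ lmark G MVar :: l, s)
       (o ++ flatten [seq encode_var G' (name j v) ++ elt_out j d | j <- countdown i])).
Proof.
move=> + ds; elim: i c0 o => [|i IH] c0 o iM st.
  have -> : 1 * (size v).+1.*2 = 1 + (size v + (size v).+1) by lia.
  apply: reach_trans (reach1 st) _; apply: reach_trans; first exact: copy_bits.
  apply: (@reach_le _ _ T 1) => //; apply: reach1.
  rewrite [flatten _](_ : _ = encode_var G' (name 0 v) ++ elt_out 0 d); last exact: cats0.
  rewrite encode_name /tstep /taction.
  case: d ds st => [d|] ds st /=.
    by rewrite inordK //= -!catA.
  clear st; have {ds} := ds erefl.
  by case: s => [|[[[m|//]|//]|r] s] _ /=; rewrite inordK //= -!catA cats0.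
have -> : i.+2 * (size v).+1.*2
   = 1 + (size v + (1 + (size v + i.+1 * (size v).+1.*2))) by lia.
apply: reach_trans (reach1 st) _; apply: reach_trans; first exact: copy_bits.
have [z ez] : exists z,
    zmove MoveLeft (rev (bits v) ++ lmark G MVar :: l, elt_in d ++ s) = Some z.
  by case: (rev _) => [|x l'] /=; eexists.
have st1 : tstep (cfg (b, Some (false, inord i.+1))
     (rev (bits v) ++ lmark G MVar :: l, elt_in d ++ s)
     ((o ++ name_prefix i.+1) ++ map (lbit G') v)) =
   Some (cfg (b, Some (true, inord i)) z
      (o ++ encode_var G' (name i.+1 v) ++ elt_out i.+1 d)).
  clear IH; move: ez; rewrite encode_name /tstep /taction.
  case: d ds st => [d|] ds st /=.
    by rewrite inordK //= => ->; rewrite -!catA.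
  clear st; have {ds} := ds erefl.
  by case: s => [|[[[m|//]|//]|r] s] _ /=; rewrite inordK //= => ->;
     rewrite -!catA cats0.
apply: reach_trans (reach1 st1) _; apply: reach_trans; first exact: (go_back _ _ _ ez).
rewrite [flatten _](_ : _ = (encode_var G' (name i.+1 v) ++ elt_out i.+1 d) ++
  flatten [seq encode_var G' (name j v) ++ elt_out j d | j <- countdown i]) //
  [o ++ (_ ++ flatten _)]catA.
apply: IH; first exact: ltnW.
by rewrite /tstep /taction /= inordK // ltnS ltnW.
Qed.

Let K := M.+1.*2.

(** Each input letter is charged [K] steps, so the bound is additive under concatenation and whole
    encodings are assembled from their pieces. *)
Definition consumes (w : seq A) (b : bool) (u : seq B) (b' : bool) : Prop :=
  forall l s o, ended s ->
  reach (K * size w) (cfg (b, None) (l, w ++ s) o)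
    (cfg (b', None) (rev w ++ l, s) (o ++ u)).

Lemma consumes_nil b : consumes [::] b [::] b.
Proof. by move=> l s o _; rewrite cats0; constructor. Qed.

Lemma consumes_cat w1 w2 u1 u2 b1 b2 b3 :
  ended w2 -> consumes w1 b1 u1 b2 -> consumes w2 b2 u2 b3 ->
  consumes (w1 ++ w2) b1 (u1 ++ u2) b3.
Proof.
move=> e2 c1 c2 l s o es; rewrite size_cat mulnDr rev_cat -!catA [o ++ _]catA.
apply: reach_trans; last exact: c2.
by apply: c1; case: w2 e2 {c2}.
Qed.

Lemma consumes_flatten (I : Type) (f : I -> seq A) (g : I -> seq B) b (r : seq I) :
  (forall i, ended (f i)) -> (forall i, consumes (f i) b (g i) b) ->
  ended (flatten (map f r)) /\ consumes (flatten (map f r)) b (flatten (map g r)) b.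
Proof.
move=> ef cf; elim: r => [|i r [IHe IHc]] /=; first by split=> //; apply: consumes_nil.
split; last exact: consumes_cat.
by have := ef i; case: (f i).
Qed.

Lemma consumes_entry b v d :
  forall l s o, (d = None -> ended s) ->
  reach (K * size (encode_var G v ++ elt_in d))
    (cfg (b, None) (l, (encode_var G v ++ elt_in d) ++ s) o)
    (cfg (b, None) (rev (encode_var G v ++ elt_in d) ++ l, s)
      (o ++ flatten [seq encode_var G' (name j v) ++ elt_out j d
                       | j <- countdown (if b then M else 0)])).
Proof.
move=> l s o ds.
have := @copy_var b (if b then M else 0) v d l s o (cfg (b, None)
  (l, (encode_var G v ++ elt_in d) ++ s) o).
rewrite rev_cat rev_cons -!catA cat_rcons => H.
apply: reach_le (H _ _ _) => //.
- rewrite size_cat /= size_map /K; case: b {H}; nia.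
- by case: b {H}.
rewrite /tstep /taction /=; case: b {H} => /=; congr (Some (TConfig _ _ _ _)).
  by congr (_, Some (_, _)); apply: val_inj; rewrite /= inordK.
by congr (_, Some (_, _)); apply: val_inj; rewrite /= inordK.
Qed.

Lemma consumes_vars X : consumes (encode_vars G X) true (encode_vars G' (copies M X)) true.
Proof.
have [|v|_] := @consumes_flatten _ (encode_var G)
  (fun v => flatten [seq encode_var G' (name j v) | j <- countdown M]) true X.
- by [].
- move=> l s o es; have := @consumes_entry true v None l s o (fun _ => es).
  by rewrite cats0; under eq_map => j do rewrite cats0.
by rewrite /encode_vars /copies flatten_allpairs.
Qed.

Lemma consumes_args X :
  consumes (encode_vars G X) false (encode_vars G' (map (name 0) X)) false.
Proof.
have [|v|_] := @consumes_flatten _ (encode_var G)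
  (fun v => encode_var G' (name 0 v)) false X.
- by [].
- move=> l s o es; have := @consumes_entry false v None l s o (fun _ => es).
  by rewrite /= !cats0.
by rewrite /encode_vars -map_comp.
Qed.

(** The flag on entry is arbitrary because the constraint mark resets it to [true]; the relation
    letter then sets it to [false], so that arguments get copy 0 only. *)
Lemma consumes_constraint b c :
  consumes (encode_constraint c) b (encode_constraint (split_constraint tag_trel M e c)) false.
Proof.
rewrite /encode_constraint -cat1s -[lmark G' _ :: _]cat1s.
have [||ep cp] := @consumes_flatten _
  (fun yd => rcons (encode_var G yd.1) (lelt G yd.2))
  (fun yd => flatten [seq rcons (encode_var G' (name j yd.1)) (lelt G' (e j yd.2))
                         | j <- countdown M]) true (premise c).
- by [].
- move=> yd l s o es; have := @consumes_entry true yd.1 (Some yd.2) l s o.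
  rewrite cats1; under eq_map => j do rewrite cats1.
  exact.
apply: (@consumes_cat _ _ _ _ _ true).
- by case: (flatten _) ep.
- by move=> l s o es; apply: (@reach_le _ _ T 1) => //; apply: reach1.
apply: (@consumes_cat _ _ _ _ _ true) => //.
  by rewrite flatten_allpairs.
apply: (@consumes_cat [:: lrel (crel c)] _ [:: lrel (trel (crel c))] _ _ false).
- by case: (tval (cargs c)).
- by move=> l s o es; apply: (@reach_le _ _ T 1) => //; apply: reach1.
exact: consumes_args.
Qed.

Lemma consumes_block m X : m \in [:: MExists; MForall] ->
  consumes (lmark G m :: encode_vars G X) true
    (lmark G' m :: encode_vars G' (copies M X)) true.
Proof.
move=> mm; rewrite -cat1s -[lmark G' _ :: _]cat1s; apply: (@consumes_cat _ _ _ _ _ true).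
- by case: X.
- move=> l s o es; apply: (@reach_le _ _ T 1) => //; apply: reach1.
  by move: mm; rewrite !inE => /orP[]/eqP->.
exact: consumes_vars.
Qed.

(** The final flag depends on whether the matrix is empty, and it is irrelevant for halting. *)
Lemma consumes_formula (phi : formula G) : exists b,
  consumes (encode_formula phi) true
    (encode_formula (split_formula tag_trel M e phi)) b.
Proof.
have [em [b cm]] : ended (flatten (map (@encode_constraint _ G) (matrix phi))) /\
   exists b, consumes (flatten (map (@encode_constraint _ G) (matrix phi))) true
     (flatten (map (@encode_constraint _ G')
          (matrix (split_formula tag_trel M e phi)))) b.
  rewrite /= -map_comp; case: (matrix phi) => [|c C].
    by split=> //; exists true; apply: consumes_nil.
  split=> //; exists false.
  have [//|c'|ef cf] := @consumes_flatten _ (@encode_constraint _ G)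
    (@encode_constraint _ G' \o split_constraint tag_trel M e) false C.
    exact: consumes_constraint.
  exact: (consumes_cat ef (consumes_constraint true c) cf).
exists b; rewrite /encode_formula /= -!cat_cons.
have [|YX|ea ca] := @consumes_flatten _
  (fun YX => (lmark G MForall :: encode_vars G YX.1)
                  ++ (lmark G MExists :: encode_vars G YX.2))
  (fun YX => (lmark G' MForall :: encode_vars G' (copies M YX.1))
                  ++ (lmark G' MExists :: encode_vars G' (copies M YX.2)))
  true (alternations phi).
- by [].
  by apply: (@consumes_cat _ _ _ _ _ true) => //;
     apply: consumes_block; rewrite !inE eqxx ?orbT.
apply: (@consumes_cat _ _ _ _ _ true).
- by case: (flatten _) ea.
- by apply: consumes_block; rewrite !inE eqxx.
apply: (@consumes_cat _ _ _ _ _ true) => //.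
by rewrite /map_blocks -map_comp.
Qed.

Lemma split_polynomial_time :
  @polynomial_time (QCSPE G) (QCSPE G') (split_sentence tag_trel M e).
Proof.
pose c := K * (emit_bound T).*2.+1 + 2.
exists (compile T), c, 1 => phi /=.
have [b cb] := consumes_formula phi.
have r := cb [::] [::] [::] isT; rewrite !cats0 in r.
apply: outputs_within_le (compile_correct r erefl).
by rewrite expn1 /c mulnDl mulnAC -addnA leq_add2l addnA leq_addl.
Qed.

End SplitTransducer.

(** * Targets with one element *)

Inductive check_state :=
  Scan | Premise | Rewind | Compare | Match | Skip | Return | Append | Leave | Stop.

Definition check_code (q : check_state) : 'I_10 :=
  match q with
  | Scan => inord 0 | Premise => inord 1 | Rewind => inord 2 | Compare => inord 3
  | Match => inord 4 | Skip => inord 5 | Return => inord 6 | Append => inord 7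
  | Leave => inord 8 | Stop => inord 9
  end.
Definition check_decode (i : 'I_10) : check_state :=
  match val i with
  | 0 => Scan | 1 => Premise | 2 => Rewind | 3 => Compare | 4 => Match
  | 5 => Skip | 6 => Return | 7 => Append | 8 => Leave | _ => Stop
  end.
Lemma check_codeK : cancel check_code check_decode.
Proof. by case; rewrite /check_decode /= inordK. Qed.
HB.instance Definition _ := Finite.copy check_state (can_type check_codeK).

Section Singleton.
Variables (D D' : finType) (G : language D) (G' : language D').
Variable trel : seq_sub G -> seq_sub G'.
Hypothesis tag_trel : forall r, tag (ssval (trel r)) = tag (ssval r).

Definition compatible (e1 e2 : var * D) : bool := (e1.1 == e2.1) ==> (e1.2 == e2.2).

(** Pairwise compatibility of the premise is its satisfiability by some assignment of the universal
    variables. *)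
Definition refuting (c : ext_constraint G) : bool :=
  (tagged (ssval (trel (crel c))) == set0) && pairwise compatible (premise c).

(** The false sentence uses the empty relation found. Its only variable is named by the empty word
    and is declared only for positive arity, so a nullary relation costs no block. *)
Definition verdict (o : option (seq_sub G)) : formula G' :=
  if o is Some r then
    Formula (nseq (0 < tag (ssval (trel r))) [::]) [::]
      [:: @ExtConstraint _ _ [::] (trel r) (nseq_tuple _ ([::] : var))]
  else Formula [::] [::] [::].

Definition refutation (C : seq (ext_constraint G)) : option (seq_sub G) :=
  ohead [seq crel c | c <- C & refuting c].

Definition verdict_formula (phi : formula G) : formula G' :=
  verdict (refutation (matrix phi)).

Lemma verdict_wf o : well_formed (verdict o).
Proof.
case: o => [r|] //; rewrite /well_formed /= !cats0 !andbT; apply/andP; split.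
  by case: (0 < _).
by apply/allP => x /nseqP[-> ->].
Qed.

Definition verdict_sentence (phi : sentence G) : sentence G' :=
  Sentence (verdict_wf (refutation (matrix phi))).

(** If the relation has positive arity, the refuting constraint has an argument, which is declared
    in [phi]; so [phi] has a nonempty block too. *)
Lemma num_blocks_verdict (phi : formula G) :
  well_formed phi -> num_blocks (verdict_formula phi) <= num_blocks phi.
Proof.
case/and3P=> _ _; rewrite /verdict_formula /refutation.
elim: (matrix phi) => //= c C IH /andP[/andP[_ /allP ac] /IH {}IH].
case: ifP => //= _.
suff H : 0 < tag (ssval (trel (crel c))) -> 0 < num_blocks phi.
  by rewrite {1}/num_blocks /= addn0; case: posnP => // /H.
rewrite /num_blocks -has_count => kpos.
have [x xc] : exists x, x \in (cargs c : seq var).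
  have : size (cargs c) > 0 by rewrite size_tuple -tag_trel.
  by case: (tval _) => // x s _; exists x; rewrite mem_head.
have xE := ac x xc; have : x \in flatten (blocks phi).
  by rewrite (perm_mem (perm_blocks phi)) mem_cat xE.
by case/flattenP=> X Xb xX; apply/hasP; exists X => //; case: X xX {Xb}.
Qed.

Section Truth.
Variables (h : D -> D') (b0 : D).
Hypothesis hom_h : forall r s, in_rel (ssval r) s -> in_rel (ssval (trel r)) (map h s).
Hypothesis const_rel : forall r, tagged (ssval (trel r)) != set0 ->
  in_rel (ssval r) (nseq (tag (ssval r)) b0).

Lemma holds_from_const s (C : seq (ext_constraint G)) (U : pred var) E a :
  {in flatten [seq YX.1 | YX <- s], forall y, U y} ->
  {in flatten [seq YX.2 | YX <- s], forall x, ~~ U x} ->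
  {in E, forall x, ~~ U x /\ a x = b0} ->
  (forall a', {in E ++ flatten [seq YX.2 | YX <- s], forall x, a' x = b0} ->
     holds_matrix a' C) ->
  holds_from s C a.
Proof.
elim: s E a => [|[Y X] s IH] E a /= sY sX aE hC.
  by apply: hC => x; rewrite cats0 => /aE[].
move=> a1 aa1; exists (fun v => if v \in X then b0 else a1 v).
  by move=> v /negPf->.
apply: (IH (E ++ X)); last by rewrite -catA.
- by move=> y ys; apply: sY; rewrite mem_cat ys orbT.
- by move=> x xs; apply: sX; rewrite mem_cat xs orbT.
move=> x; rewrite mem_cat; case: ifPn => [xX _|xX].
  by split=> //; apply: sX; rewrite mem_cat xX.
rewrite orbF => /aE[nU <-]; split=> //; apply: aa1.
by apply: contra nU => xY; apply: sY; rewrite mem_cat xY.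
Qed.

(** The universal player passes, keeping the current values in every block. As the initial
    assignment of a sentence is arbitrary, any fixed universal play can be stored in it
    beforehand. *)
Lemma holds_from_frozen s (C : seq (ext_constraint G)) (U : pred var) a :
  {in flatten [seq YX.2 | YX <- s], forall x, ~~ U x} ->
  holds_from s C a ->
  exists2 a', (forall v, U v -> a' v = a v) & holds_matrix a' C.
Proof.
elim: s a => [|[Y X] s IH] a /= sX; first by exists a.
case/(_ a (fun v _ => erefl)) => a1 aa1 /IH[x xs|a2 aa2 ha2].
  by apply: sX; rewrite mem_cat xs orbT.
exists a2 => // v Uv; rewrite aa2 // aa1 //.
by apply/negP => vX; have := sX v; rewrite mem_cat vX Uv => /(_ isT).
Qed.

Definition premise_choice (p : seq (var * D)) (v : var) : D :=
  if [seq yd.2 | yd <- p & yd.1 == v] is d :: _ then d else b0.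

Lemma premise_choiceE p yd :
  pairwise compatible p -> yd \in p -> premise_choice p yd.1 = yd.2.
Proof.
rewrite /premise_choice; elim: p => //= e p IH /andP[/allP ep cp].
rewrite inE => /orP[/eqP <-|yp]; first by rewrite eqxx.
case: eqP => [eq|_]; last exact: IH.
by apply/eqP; have := ep _ yp; rewrite /compatible eq eqxx.
Qed.

Lemma verdict_true phi :
  well_formed phi -> (true_formula phi <-> true_formula (verdict_formula phi)).
Proof.
move=> wf; have fX := first_not_universal wf; have sX := existential_block wf.
have sY := @universal_block _ _ phi.
rewrite /verdict_formula /refutation.
case hr: ([seq c <- matrix phi | refuting c] : seq _) => [|c C] /=.
  split=> _ => [a0|a0]; first by exists a0.
  exists (fun v => if v \in first_block phi then b0 else a0 v).
    by move=> v /negPf->.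
  apply: (holds_from_const (E := first_block phi) sY sX).
    by move=> v vX; rewrite vX; split=> //; apply: fX.
  have /and3P[_ _] := wf; rewrite -/(existential_vars phi).
  move: hr; rewrite /holds_matrix; elim: (matrix phi) => //= c C IH.
  case: ifPn => // nr /IH{}IH /andP[/andP[_ /allP ac] /IH{}IH] a aE.
  split; last exact: IH.
  apply/holds_constraintE => hp.
  have -> : map a (cargs c) = nseq (tag (ssval (crel c))) b0.
    transitivity (nseq (size (cargs c)) b0); last by rewrite size_tuple.
    elim: (tval _) ac => //= x s IHs ac; rewrite aE ?IHs ?ac ?mem_head //.
    by move=> y ys; apply: ac; rewrite inE ys orbT.
  (* A premise made true by an assignment is pairwise compatible; as the constraint is not refuting,
     its translated relation is nonempty. *)
  apply: const_rel; apply: contra nr => bad; rewrite /refuting bad /=.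
  have : {in premise c &, forall e1 e2, compatible e1 e2}.
    by move=> e1 e2 /hp p1 /hp p2; rewrite /compatible -p1 -p2; apply/implyP => /eqP ->.
  elim: (premise c) => //= e p IHp cp; rewrite IHp ?andbT.
    by apply/allP => e' ep; apply: cp; rewrite ?inE ?eqxx ?ep ?orbT.
  by move=> e1 e2 p1 p2; apply: cp; rewrite inE ?p1 ?p2 orbT.
have [rc hC] : refuting c /\ forall a, holds_matrix a (matrix phi) -> holds_constraint a c.
  move: hr; elim: (matrix phi) => //= c' C' IH; case: ifP => [r' [<- _]|_ /IH[rc hC]].
    by split=> // a [].
  by split=> // a [_]; apply: hC.
case/andP: rc => bad cp.
split=> H; exfalso.
  have [a aX ha] := H (premise_choice (premise c)).
  have [a' aa' /hC/holds_constraintE hc] := holds_from_frozen sX ha.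
  have : in_rel (ssval (trel (crel c))) (map h (map a' (cargs c))).
    apply/hom_h/hc => yd ydp.
    have ydU : yd.1 \in universal_vars phi.
      have /and3P[_ _ wC] := wf.
      move: hr wC; elim: (matrix phi) => //= c' C' IH.
      case: ifP => _ => [[-> _]|hr] /andP[/andP[/allP pc _]]; last exact: IH.
      by move=> _; apply: pc.
    rewrite aa' // aX ?premise_choiceE //.
    by apply/negP => /fX; rewrite /= ydU.
  by case/existsP=> t; rewrite (eqP bad) inE.
have [a _ /= [hc _]] := H (fun _ => h b0).
by have := hc (fun _ => ltac:(by [])); rewrite (eqP bad) inE.
Qed.

End Truth.
End Singleton.

Arguments compatible {D}.

(** * Searching for a refuting constraint in polynomial time *)

Section CheckTransducer.
Variables (D D' : finType) (G : language D) (G' : language D').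
Variable trel : seq_sub G -> seq_sub G'.

Local Notation A := (letter G).
Local Notation B := (letter G').

Definition announce (o : option (seq_sub G)) : seq B := encode_formula (verdict trel o).

(* The auxiliary tape holds, behind the last [MConstraint], the premise of the
   current constraint as far as it has been read. *)
Definition check_tr (q : check_state) (x y : option A) :
    option (action check_state A B) :=
  match q with
  | Scan =>
    match x with
    | Some (inl (inl (inl MConstraint))) =>
        Some (Action Premise MoveRight x MoveRight [::])
    | Some _ => Some (Action Scan MoveRight None Stay [::])
    | None => Some (Action Stop Stay None Stay (announce None))
    end
  | Premise =>
    match x with
    | Some (inr r) =>
        if tagged (ssval (trel r)) == set0 then
          Some (Action Stop Stay None Stay (announce (Some r)))
        else Some (Action Scan MoveRight None Stay [::])
    | _ => Some (Action Rewind Stay None MoveLeft [::])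
    end
  | Rewind =>
    match y with
    | Some (inl (inl (inl MConstraint))) => Some (Action Compare Stay None MoveRight [::])
    | _ => Some (Action Rewind Stay None MoveLeft [::])
    end
  | Compare =>
    match y with
    | None => Some (Action Append Stay None Stay [::])
    | Some _ => Some (Action Match MoveRight None MoveRight [::])
    end
  | Match =>
    match x, y with
    | Some (inl (inl (inr c))), Some (inl (inl (inr c'))) =>
        if c == c' then Some (Action Match MoveRight None MoveRight [::])
        else Some (Action Skip Stay None Stay [::])
    | Some (inl (inr d)), Some (inl (inr d')) =>
        if d == d' then Some (Action Skip Stay None Stay [::])
        else Some (Action Leave Stay None Stay [::])
    | _, _ => Some (Action Skip Stay None Stay [::])
    end
  | Skip =>
    match y with
    | Some (inl (inr _)) => Some (Action Return Stay None MoveRight [::])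
    | _ => Some (Action Skip Stay None MoveRight [::])
    end
  | Return =>
    match x with
    | Some (inl (inl (inl MVar))) => Some (Action Compare Stay None Stay [::])
    | _ => Some (Action Return MoveLeft None Stay [::])
    end
  | Append =>
    match x with
    | Some (inl (inr _)) => Some (Action Premise MoveRight x MoveRight [::])
    | _ => Some (Action Append MoveRight x MoveRight [::])
    end
  | Leave =>
    match y with
    | None => Some (Action Scan Stay None Stay [::])
    | Some _ => Some (Action Leave Stay None MoveRight [::])
    end
  | Stop => None
  end.

Definition check_transducer : transducer A B :=
  @Transducer A B check_state Scan check_tr.

Let T := check_transducer.
Notation reach := (@reach _ _ T).
Notation cfg q z za := (@TConfig _ _ T q z za [::]).
Notation bits := (map (lbit G)).

Definition entry (e : var * D) : seq A := rcons (encode_var G e.1) (lelt G e.2).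
Definition entries (p : seq (var * D)) : seq A := flatten (map entry p).

Lemma entryE e : entry e = lmark G MVar :: bits e.1 ++ [:: lelt G e.2].
Proof. by rewrite /entry /encode_var -cats1. Qed.

Lemma size_entry e : size (entry e) = (size e.1).+2.
Proof. by rewrite entryE /= size_cat size_map addn1. Qed.

Lemma entries_cons e p : entries (e :: p) = entry e ++ entries p.
Proof. by []. Qed.

Lemma entries_cat p q : entries (p ++ q) = entries p ++ entries q.
Proof. by rewrite /entries map_cat flatten_cat. Qed.

Lemma size_entries p : size p <= size (entries p).
Proof.
elim: p => // e p IH; rewrite entries_cons.
rewrite size_cat size_entry -[size (e :: p)]/(size p).+1; lia.
Qed.

Definition unmarked (x : A) : bool :=
  if x is inl (inl (inl MConstraint)) then false else true.

Lemma unmarked_bits v : all unmarked (bits v).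
Proof. by elim: v. Qed.

Lemma unmarked_entries p : all unmarked (entries p).
Proof.
elim: p => // e p IH; rewrite entries_cons.
rewrite all_cat IH andbT.
by rewrite entryE /= all_cat unmarked_bits.
Qed.

Lemma unmarked_vars X : all unmarked (encode_vars G X).
Proof.
by elim: X => //= v X IH; rewrite /encode_vars /= all_cat unmarked_bits.
Qed.

Lemma scan_unmarked w l s za :
  all unmarked w ->
  reach (size w) (cfg Scan (l, w ++ s) za) (cfg Scan (rev w ++ l, s) za).
Proof.
elim: w l => [|x w IH] l /=; first by constructor.
case/andP=> ux /(IH (x :: l)); rewrite rev_cons cat_rcons; apply: reachS.
by case: x ux => [[[[]|]|]|].
Qed.

Lemma rewind_aux w z la s za :
  all unmarked w -> zmove MoveLeft (rev w ++ lmark G MConstraint :: la, s) = Some za ->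
  reach (size w).+1 (cfg Rewind z za)
    (cfg Compare z (lmark G MConstraint :: la, w ++ s)).
Proof.
elim/last_ind: w s za => [|w x IH] s za /=.
  by move=> _ [<-]; apply: reach1.
rewrite all_rcons rev_rcons => /andP[ux uw] /= [<-]; rewrite size_rcons cat_rcons.
have [za' ez] : exists za',
    zmove MoveLeft (rev w ++ lmark G MConstraint :: la, x :: s) = Some za'.
  by case: (rev w) => [|y l'] /=; eexists.
apply: (@reachS _ _ T _ _ (cfg Rewind z za')); last exact: IH.
by move: ez; rewrite /tstep /taction /=; case: x ux => [[[[]|?]|?]|?] //= _ ->.
Qed.

Lemma skip_aux v d z la sa :
  reach (size v).+1 (cfg Skip z (la, bits v ++ lelt G d :: sa))
    (cfg Return z (lelt G d :: rev (bits v) ++ la, sa)).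
Proof.
elim: v la => [|c v IH] la /=; first by apply: reach1.
apply: reachS; first by reflexivity.
by rewrite rev_cons cat_rcons; apply: IH.
Qed.

Definition not_var (x : A) : bool :=
  if x is inl (inl (inl MVar)) then false else true.

Lemma return_in v l x s za :
  not_var x ->
  reach (size v).+2 (cfg Return (rev (bits v) ++ lmark G MVar :: l, x :: s) za)
    (cfg Compare (l, lmark G MVar :: bits v ++ x :: s) za).
Proof.
elim/last_ind: v x s => [|v c IH] x s ux.
  apply: (@reachS _ _ T _ _ (cfg Return (l, lmark G MVar :: x :: s) za)).
    by case: x ux => [[[[]|]|]|].
  exact: reach1.
rewrite map_rcons rev_rcons size_rcons cat_rcons.
apply: (@reachS _ _ T _ _
  (cfg Return (rev (bits v) ++ lmark G MVar :: l, lbit G c :: x :: s) za)); last exact: IH.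
by case: x ux => [[[[]|]|]|].
Qed.

Lemma append_in v d l s la :
  reach (size v).+2 (cfg Append (l, entry (v, d) ++ s) (la, [::]))
    (cfg Premise (rev (entry (v, d)) ++ l, s) (rev (entry (v, d)) ++ la, [::])).
Proof.
rewrite entryE /= rev_cons rev_cat /= -!catA !cat_rcons.
apply: (@reachS _ _ T _ _ (cfg Append (lmark G MVar :: l, bits v ++ lelt G d :: s)
  (lmark G MVar :: la, [::]))); first by [].
elim: v (_ :: l) (_ :: la) => [|c v IH] l' la' /=; first by apply: reach1.
apply: reachS; first by reflexivity.
by rewrite rev_cons !cat_rcons; apply: IH.
Qed.

Lemma match_common u l s la sa :
  reach (size u) (cfg Match (l, bits u ++ s) (la, bits u ++ sa))
    (cfg Match (rev (bits u) ++ l, s) (rev (bits u) ++ la, sa)).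
Proof.
elim: u l la => [|c u IH] l la /=; first by constructor.
rewrite rev_cons !cat_rcons; apply: reachS; last exact: IH.
by rewrite /tstep /taction /= eqxx.
Qed.

Lemma common_prefix (v v' : seq bool) : exists u w w',
  [/\ v = u ++ w, v' = u ++ w' &
      match w, w' with c :: _, c' :: _ => c != c' | _, _ => true end].
Proof.
elim: v v' => [|c v IH] [|c' v'].
- by exists [::], [::], [::].
- by exists [::], [::], (c' :: v').
- by exists [::], (c :: v), [::].
case: (eqVneq c c') => [<-|ne]; last by exists [::], (c :: v), (c' :: v').
have [u [w [w' [-> -> ok]]]] := IH v'.
by exists (c :: u), w, w'.
Qed.

(** The heads run through the common prefix of the two names. A clash needs the names to end
    together with different values; every other outcome, equal entries included, sends the auxiliary
    head past its entry and the input head back to the mark. *)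
Lemma match_var v d s v' d' sa l la :
  let c0 := cfg Match (lmark G MVar :: l, bits v ++ lelt G d :: s)
              (la, bits v' ++ lelt G d' :: sa) in
  if compatible (v', d') (v, d) then
    reach (size v + size v' + 4) c0
      (cfg Compare (l, lmark G MVar :: bits v ++ lelt G d :: s)
         (lelt G d' :: rev (bits v') ++ la, sa))
  else exists l' la',
    reach (size v + size v' + 4) c0
      (cfg Leave (l', lelt G d :: s) (la', lelt G d' :: sa)).
Proof.
move=> c0; have [u [w [w' [ev ev' ww]]]] := common_prefix v v'.
have r0 : reach (size u) c0
    (cfg Match (rev (bits u) ++ lmark G MVar :: l, bits w ++ lelt G d :: s)
       (rev (bits u) ++ la, bits w' ++ lelt G d' :: sa)).
  by rewrite /c0 ev ev' !map_cat -!catA; apply: match_common.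
have [x [s' [es nx]]] : exists x s', bits w ++ lelt G d :: s = x :: s' /\ not_var x.
  by case: w {ev r0 ww} => [|c w]; do 2!eexists; split.
have mismatch :
    tstep (cfg Match (rev (bits u) ++ lmark G MVar :: l, bits w ++ lelt G d :: s)
       (rev (bits u) ++ la, bits w' ++ lelt G d' :: sa)) =
    Some (cfg Skip (rev (bits u) ++ lmark G MVar :: l, bits w ++ lelt G d :: s)
       (rev (bits u) ++ la, bits w' ++ lelt G d' :: sa)) ->
    reach (size v + size v' + 4) c0
      (cfg Compare (l, lmark G MVar :: bits v ++ lelt G d :: s)
         (lelt G d' :: rev (bits v') ++ la, sa)).
  move=> st; apply: (@reach_le _ _ T (size u + (1 + ((size w').+1 + (size u).+2)))).
    by rewrite ev ev' !size_cat; lia.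
  apply: reach_trans r0 _; apply: reach_trans (reach1 st) _.
  apply: reach_trans; first exact: skip_aux.
  rewrite ev ev' !map_cat rev_cat -!catA es; apply: return_in; exact: nx.
case: w w' ev ev' ww r0 es mismatch => [|c w] [|c' w'] /= ev ev' ww r0 es mismatch.
- have -> : compatible (v', d') (v, d) = (d' == d).
    by rewrite /compatible /= ev ev' eqxx.
  case: eqVneq => [ed|nd].
    by apply: mismatch; rewrite /tstep /taction /= ed eqxx.
  exists (rev (bits u) ++ lmark G MVar :: l), (rev (bits u) ++ la).
  apply: (@reach_le _ _ T (size u + 1)).
    by rewrite ev size_cat; lia.
  apply: reach_trans r0 (reach1 _).
  by rewrite /tstep /taction /= eq_sym (negPf nd).
- have -> : compatible (v', d') (v, d).
    apply/implyP => /eqP/(congr1 size); rewrite /= ev ev' !size_cat /=; lia.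
  exact: mismatch.
- have -> : compatible (v', d') (v, d).
    apply/implyP => /eqP/(congr1 size); rewrite /= ev ev' !size_cat /=; lia.
  exact: mismatch.
have -> : compatible (v', d') (v, d).
  by apply/implyP; rewrite /= ev ev' eqseq_cat // eqxx /= eqseq_cons eq_sym (negPf ww).
by apply: mismatch; rewrite /tstep /taction /= (negPf ww).
Qed.

Lemma compare_entry e e' s l la sa :
  let c0 := cfg Compare (l, entry e ++ s) (la, entry e' ++ sa) in
  if compatible e' e then
    reach (size (entry e) + size (entry e') + 4) c0
      (cfg Compare (l, entry e ++ s) (rev (entry e') ++ la, sa))
  else exists l' la' w,
    [/\ all unmarked w, size w <= size (entry e) &
    reach (size (entry e) + size (entry e') + 4) c0
      (cfg Leave (l', w ++ s) (la', lelt G e'.2 :: sa))].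
Proof.
case: e e' => v d [v' d'] c0; rewrite {}/c0 !size_entry !entryE.
have := match_var v d s v' d' sa l (lmark G MVar :: la).
rewrite /= -!catA /=.
have st : tstep (cfg Compare (l, lmark G MVar :: bits v ++ lelt G d :: s)
    (la, lmark G MVar :: bits v' ++ lelt G d' :: sa)) =
  Some (cfg Match (lmark G MVar :: l, bits v ++ lelt G d :: s)
    (lmark G MVar :: la, bits v' ++ lelt G d' :: sa)) by [].
case: ifP => _ => [r|[l' [la' r]]].
  apply: (@reach_le _ _ T (1 + (size v + size v' + 4))); first by lia.
  apply: reach_trans (reach1 st) _.
  by rewrite rev_cons rev_cat cat_rcons -catA.
exists l', la', [:: lelt G d]; split=> //=.
apply: (@reach_le _ _ T (1 + (size v + size v' + 4))); first by lia.
exact: reach_trans (reach1 st) _.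
Qed.

Lemma leave_aux z la sa :
  reach (size sa).+1 (cfg Leave z (la, sa)) (cfg Scan z (rev sa ++ la, [::])).
Proof.
elim: sa la => [|x sa IH] la /=; first by apply: reach1.
by apply: reachS; last (rewrite rev_cons cat_rcons; apply: IH).
Qed.

(** Each recorded entry costs at most [N + 4] steps. After a clash the input head is still inside
    the entry; the remainder [w] has no constraint mark, so [Scan] can pass over it. *)
Lemma compare_entries N e p s l la :
  size (entry e) + size (entries p) <= N ->
  let c0 := cfg Compare (l, entry e ++ s) (la, entries p) in
  if all (compatible^~ e) p then
    reach (size p * (N + 4) + (size (entry e)).+1) c0
      (cfg Premise (rev (entry e) ++ l, s) (rev (entry e) ++ rev (entries p) ++ la, [::]))
  else exists l' la' w,
    [/\ all unmarked w, size w <= N &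
    reach (size p * (N + 4) + N.+1) c0 (cfg Scan (l', w ++ s) (la', [::]))].
Proof.
elim: p la => [|e' p IH] la.
  move=> _ c0; have st : tstep c0 = Some (cfg Append (l, entry e ++ s) (la, [::])) by [].
  have := append_in e.1 e.2 l s la; rewrite -surjective_pairing => r.
  rewrite [all _ _]/=.
  apply: reach_le (reach_trans (reach1 st) r); rewrite size_entry; lia.
rewrite entries_cons.
rewrite size_cat => leN c0; rewrite [all _ _]/= [size (_ :: _)]/=.
have := compare_entry e e' s l la (entries p); cbv zeta.
case: ifP => _ => [r|[l' [la' [w [uw sw r]]]]]; rewrite ?andTb ?andFb.
  have {IH} := IH (rev (entry e') ++ la) ltac:(lia); cbv zeta.
  have step k : size (entry e) + size (entry e') + 4 + (size p * (N + 4) + k) <=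
      (size p).+1 * (N + 4) + k by rewrite mulSn; lia.
  case: ifP => _ => [r'|[l' [la' [w [uw sw r']]]]].
    rewrite rev_cat -catA; apply: reach_le (step _) _; exact: reach_trans r r'.
  exists l', la', w; split=> //; apply: reach_le (step _) _; exact: reach_trans r r'.
exists l', (rev (lelt G e'.2 :: entries p) ++ la'), w; split=> //; first by lia.
apply: (@reach_le _ _ T ((size (entry e) + size (entry e') + 4) + (size (entries p)).+2)).
  rewrite mulSn; have := size_entry e; have := size_entry e'; lia.
apply: reach_trans r _; exact: (leave_aux _ _ (lelt G e'.2 :: entries p)).
Qed.

(** [t] allows for [N] comparisons of [N + 4] steps, one rewinding of the auxiliary tape, and one
    final append or leave. *)
Lemma premise_entry N p e s l la :
  size (entry e) + size (entries p) <= N ->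
  let c0 := cfg Premise (l, entry e ++ s) (rev (entries p) ++ lmark G MConstraint :: la, [::]) in
  let t := N * (N + 4) + N + N + 5 in
  if all (compatible^~ e) p then
    exists l', reach t c0
      (cfg Premise (l', s)
        (rev (entries (rcons p e)) ++ lmark G MConstraint :: la, [::]))
  else exists l' la' w,
    [/\ all unmarked w, size w <= N & reach t c0 (cfg Scan (l', w ++ s) (la', [::]))].
Proof.
move=> leN c0 t.
have sp := size_entries p; have se := size_entry e.
have [za ez] : exists za,
    zmove MoveLeft (rev (entries p) ++ lmark G MConstraint :: la, [::]) = Some za.
  by case: (rev _) => [|y l'] /=; eexists.
have r0 : reach (1 + (size (entries p)).+1) c0
    (cfg Compare (l, entry e ++ s) (lmark G MConstraint :: la, entries p)).
  apply: reach_trans; first apply: reach1.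
    by rewrite /c0 entryE; move: ez; rewrite /tstep /taction /= => ->.
  by have := rewind_aux (l, entry e ++ s) (unmarked_entries p) ez; rewrite cats0 entryE.
have := compare_entries s l (lmark G MConstraint :: la) leN; cbv zeta.
have le_t k : k <= N.+1 -> 1 + (size (entries p)).+1 + (size p * (N + 4) + k) <= t.
  by rewrite /t => lek; nia.
case: ifP => _ => [r|[l' [la' [w [uw sw r]]]]].
  exists (rev (entry e) ++ l).
  have -> : entries (rcons p e) = entries p ++ entry e.
    by rewrite /entries map_rcons flatten_rcons.
  rewrite rev_cat -catA; apply: reach_le (reach_trans r0 r); apply: le_t; lia.
exists l', la', w; split=> //.
apply: reach_le (reach_trans r0 r); exact: le_t.
Qed.

(** Generalised over the entries [p] already recorded, whose pairwise compatibility is the invariant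
    of the induction. *)
Lemma read_premise N p ps s l la :
  size (entries (p ++ ps)) <= N -> pairwise compatible p ->
  let c0 := cfg Premise (l, entries ps ++ s)
              (rev (entries p) ++ lmark G MConstraint :: la, [::]) in
  let t := size ps * (N * (N + 4) + N + N + 5) in
  if pairwise compatible (p ++ ps) then
    exists l' la', reach t c0 (cfg Premise (l', s) (la', [::]))
  else exists l' la' w,
    [/\ all unmarked w, size w <= N + size (entries ps)
      & reach t c0 (cfg Scan (l', w ++ s) (la', [::]))].
Proof.
elim: ps p l => [|e ps IH] p l leN cp c0 t.
  by rewrite cats0 cp; do 2!eexists; constructor.
have leN' : size (entry e) + size (entries p) <= N.
  by apply: leq_trans leN; rewrite entries_cat entries_cons !size_cat; lia.
have -> : c0 = cfg Premise (l, entry e ++ entries ps ++ s)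
    (rev (entries p) ++ lmark G MConstraint :: la, [::]).
  by rewrite /c0 entries_cons -catA.
have {t} -> : t = N * (N + 4) + N + N + 5 + size ps * (N * (N + 4) + N + N + 5).
  exact: mulSn.
have := @premise_entry N p e (entries ps ++ s) l la leN'; cbv zeta.
(* A clash of [e] with an entry of [p] decides the whole list, whatever follows. *)
have -> : pairwise compatible (p ++ e :: ps) =
    all (compatible^~ e) p && pairwise compatible (rcons p e ++ ps).
  rewrite cat_rcons; case nall: (all _ p) => //; apply/negbTE.
  by rewrite pairwise_cat allrel_consr nall.
case: ifP => pe => [[l1 r1]|[l' [la' [w [uw sw r]]]]]; rewrite ?andTb ?andFb.
  have {IH} := IH (rcons p e) l1; rewrite cat_rcons pairwise_rcons pe cp.
  move/(_ leN isT); cbv zeta.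
  case: ifP => _ => [[l' [la' r]]|[l' [la' [w [uw sw r]]]]].
    by exists l', la'; apply: reach_trans r1 r.
  exists l', la', w; split=> //; last exact: reach_trans r1 r.
  by rewrite entries_cons size_cat; lia.
exists l', la', (w ++ entries ps); split.
- by rewrite all_cat uw unmarked_entries.
- by rewrite entries_cons !size_cat; lia.
rewrite -catA; apply: reach_le r; exact: leq_addr.
Qed.

Lemma encode_constraintE (c : ext_constraint G) :
  encode_constraint c = lmark G MConstraint :: entries (premise c) ++
    lrel (crel c) :: encode_vars G (cargs c).
Proof. by []. Qed.

Definition constraint_time (N : nat) : nat := N * (N * (N + 4) + N + N + 5) + 3 * N + 2.

(** [la] is arbitrary because the auxiliary tape is never erased: a new constraint mark separates
    old records from new ones. A refuting constraint stops the run at its relation letter, so the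
    first one determines the output, as in [refutation]. *)
Lemma read_constraint N c s l la :
  size (encode_constraint c) <= N ->
  let c0 := cfg Scan (l, encode_constraint c ++ s) (la, [::]) in
  if refuting trel c then
    exists2 c', reach (constraint_time N) c0 c' &
      tcstate c' = Stop /\ tcout c' = announce (Some (crel c))
  else exists l' la', reach (constraint_time N) c0 (cfg Scan (l', s) (la', [::])).
Proof.
rewrite encode_constraintE => leN c0.
have sN : 1 + (size (entries (premise c)) + (1 + size (encode_vars G (cargs c)))) <= N.
  by have := leN; rewrite -cat1s !size_cat -cat1s size_cat.
have sp := size_entries (premise c).
pose vs := lrel (crel c) :: encode_vars G (cargs c).
have uvs : all unmarked vs by apply: unmarked_vars.
have svs : size vs = 1 + size (encode_vars G (cargs c)) by [].
have leP : size (entries ([::] ++ premise c)) <= N.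
  by rewrite cat0s; apply: leq_trans sN; lia.
have := @read_premise N [::] (premise c) (vs ++ s) (lmark G MConstraint :: l) la leP isT.
cbv zeta; rewrite cat0s /refuting.
have st : tstep c0 = Some (cfg Premise
   (lmark G MConstraint :: l, entries (premise c) ++ vs ++ s)
   (lmark G MConstraint :: la, [::])) by rewrite /c0 cat_cons -catA.
set t := _ * _.
have le_t : t <= N * (N * (N + 4) + N + N + 5) by rewrite leq_mul2r; apply/orP; right; lia.
case: ifP => _ => [[l' [la' r]]|[l' [la' [w [uw sw r]]]]]; rewrite ?andbT ?andbF; last first.
  exists (rev (w ++ vs) ++ l'), la'.
  apply: (@reach_le _ _ T (1 + (t + size (w ++ vs)))).
    by rewrite size_cat svs /constraint_time; lia.
  apply: reach_trans (reach1 st) _; apply: reach_trans r _.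
  by rewrite catA; apply: scan_unmarked; rewrite all_cat uw.
case: ifP => bad.
  eexists; last split.
  - apply: (@reach_le _ _ T (1 + (t + 1))).
      by rewrite /constraint_time; lia.
    apply: reach_trans (reach1 st) _; apply: reach_trans r _.
    by apply: reach1; rewrite /tstep /taction /= bad.
  - by [].
  - by [].
exists (rev vs ++ l'), la'.
apply: (@reach_le _ _ T (1 + (t + size vs))).
  by rewrite svs /constraint_time; lia.
apply: reach_trans (reach1 st) _; apply: reach_trans r _.
apply: (@reachS _ _ T _ _ (cfg Scan (lrel (crel c) :: l', encode_vars G (cargs c) ++ s)
  (la', [::]))); first by rewrite /tstep /taction /= bad.
rewrite rev_cons cat_rcons; exact/scan_unmarked/unmarked_vars.
Qed.

Lemma read_matrix N C l la :
  size (flatten (map (@encode_constraint _ G) C)) <= N ->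
  exists2 c', reach (size C * constraint_time N + 1)
      (cfg Scan (l, flatten (map (@encode_constraint _ G) C)) (la, [::])) c' &
    tcstate c' = Stop /\ tcout c' = announce (refutation trel C).
Proof.
elim: C l la => [|c C IH] l la; first by eexists; [apply: reach1 | split].
have -> : flatten (map (@encode_constraint _ G) (c :: C)) =
  encode_constraint c ++ flatten (map (@encode_constraint _ G) C) by [].
rewrite size_cat => leN; rewrite mulSn -addnA.
have leNc : size (encode_constraint c) <= N by lia.
have leNC : size (flatten (map (@encode_constraint _ G) C)) <= N by lia.
have := @read_constraint N c (flatten (map (@encode_constraint _ G) C)) l la leNc.
cbv zeta; rewrite /refutation /=; case: ifP => _ => [[c' r e]|[l' [la' r]]].
  by exists c' => //; apply: reach_le r; exact: leq_addr.
have [c' r' e'] := IH l' la' leNC.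
by exists c' => //; apply: reach_trans r r'.
Qed.

Lemma unmarked_prefix (phi : formula G) : exists w,
  all unmarked w /\
  encode_formula phi = w ++ flatten (map (@encode_constraint _ G) (matrix phi)).
Proof.
rewrite /encode_formula catA; eexists; split; last by [].
rewrite all_cat /= unmarked_vars /=.
by elim: (alternations phi) => //= YX s IH; rewrite all_cat IH andbT all_cat /= !unmarked_vars.
Qed.

Lemma size_matrix (C : seq (ext_constraint G)) :
  size C <= size (flatten (map (@encode_constraint _ G) C)).
Proof.
by elim: C => //= c C IH; rewrite ltnS size_cat (leq_trans IH) // leq_addl.
Qed.

(** The expanded bound is [N ^ 4 + 6 * N ^ 3 + 8 * N ^ 2 + 3 * N + 1]. Its nonconstant coefficients
    add up to 18, so 30 leaves room. *)
Lemma check_time N k m :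
  k <= N -> m <= N -> m + (k * constraint_time N + 1) <= 30 * N ^ 4 + 30.
Proof.
move=> kN mN; apply: (@leq_trans (N + (N * constraint_time N + 1))).
  by rewrite leq_add // leq_add2r leq_mul2r kN orbT.
have -> : N * constraint_time N = N ^ 4 + 6 * N ^ 3 + 8 * N ^ 2 + 2 * N.
  by rewrite /constraint_time !expnS expn0; lia.
have le4 j : 0 < j <= 4 -> N ^ j <= N ^ 4.
  case/andP=> j0 j4; case: (posnP N) => [->|N0]; first by rewrite exp0n.
  by rewrite leq_pexp2l.
have := le4 1 isT; have := le4 2 isT; have := le4 3 isT; rewrite expn1; lia.
Qed.

Lemma check_polynomial_time :
  @polynomial_time (QCSPE G) (QCSPE G') (verdict_sentence trel).
Proof.
pose c := (emit_bound T).*2.+1 * 30 + 2.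
exists (compile T), c, 4 => phi.
have [w [uw eq]] := unmarked_prefix phi.
change (outputs_within (compile T) (c * size (encode_formula phi) ^ 4 + c)
  (encode_formula phi) (announce (refutation trel (matrix phi)))).
move: eq (size_matrix (matrix phi)); set m := flatten _ => eq le_m.
set N := size (encode_formula phi).
have eN : N = size w + size m by rewrite /N eq size_cat.
have leN : size m <= N by rewrite eN leq_addl.
have [c' r [q' o']] := @read_matrix N (matrix phi) (rev w ++ [::]) [::] leN.
have r0 := @scan_unmarked w [::] m ([::], [::]) uw.
have := reach_trans r0 r; rewrite -eq.
case: c' q' o' {r} => q [li si] za o /= -> -> r.
apply: outputs_within_le (compile_correct r erefl).
have := @check_time N (size (matrix phi)) (size w) (leq_trans le_m leN) _.
rewrite eN leq_addr => /(_ isT) le_n; rewrite -eN in le_n *.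
apply: (@leq_trans ((30 * N ^ 4 + 30) * (emit_bound T).*2.+1 + 2)).
  by rewrite leq_add2r leq_mul2r le_n orbT.
rewrite /c; move: (N ^ 4) (_.*2.+1) => x y; nia.
Qed.

End CheckTransducer.

(** * Homomorphically equivalent structures *)

(** Counting: there are at least as many functions from the indices to [D'] as elements of [D], so
    ranks embed [D] among them. Already [#|D|] coordinates suffice; the extra one comes from
    indexing by [0] to [#|D|]. *)
Lemma code_exists (D D' : finType) : 1 < #|D'| ->
  exists e : nat -> D -> D',
    forall d d', (forall i, i <= #|D| -> e i d = e i d') -> d = d'.
Proof.
move=> gt1.
have le : #|D| <= #|{ffun 'I_#|D|.+1 -> D'}|.
  rewrite card_ffun card_ord; apply: leq_trans (ltnW (ltn_expl _ gt1)) _.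
  by rewrite leq_exp2l.
exists (fun i d => (enum_val (widen_ord le (enum_rank d)) : {ffun _}) (inord i)).
move=> d d' H; apply/enum_rank_inj/val_inj.
suff /(congr1 val) : widen_ord le (enum_rank d) = widen_ord le (enum_rank d') by [].
by apply: enum_val_inj; apply/ffunP => i; have := H i; rewrite inord_val; apply; rewrite -ltnS.
Qed.

Section Structures.
Variable sigma : vocabulary.

Definition relation_of (B : structure sigma) (R : symbol sigma) : relation B :=
  existT (fun k => {set k.-tuple B}) (arity R) (interp B R).

Lemma relation_of_mem (B : structure sigma) R : relation_of B R \in language_of B.
Proof. by apply/mapP; exists R; rewrite // mem_enum. Qed.

Lemma hom_in_rel (B B' : structure sigma) (h : B -> B') R s :
  homomorphism h -> in_rel (relation_of B R) s -> in_rel (relation_of B' R) (map h s).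
Proof.
move=> hom /existsP[t /andP[tR /eqP <-]].
by apply/existsP; exists [tuple of map h t]; rewrite (hom R t tR) /=.
Qed.

Variables B B' : structure sigma.

Lemma symbol_exists (r : seq_sub (language_of B)) :
  exists R, relation_of B R == ssval r.
Proof. by have /mapP[R _ ->] := ssvalP r; exists R. Qed.

(* Different symbols may have the same interpretation in [B]: one of them is
   chosen for each relation. *)
Definition symbol_of (r : seq_sub (language_of B)) : symbol sigma :=
  xchoose (symbol_exists r).

Lemma symbol_ofK r : relation_of B (symbol_of r) = ssval r.
Proof. exact/eqP/(xchooseP (symbol_exists r)). Qed.

Definition translate (r : seq_sub (language_of B)) : seq_sub (language_of B') :=
  SeqSub (relation_of_mem B' (symbol_of r)).

Lemma tag_translate r : tag (ssval (translate r)) = tag (ssval r).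
Proof. by rewrite -symbol_ofK. Qed.

Variables (h : B -> B') (h' : B' -> B).
Hypotheses (hom_h : homomorphism h) (hom_h' : homomorphism h').

Lemma translate_hom r s :
  in_rel (ssval r) s -> in_rel (ssval (translate r)) (map h s).
Proof. by rewrite -symbol_ofK; apply: hom_in_rel. Qed.

Lemma translate_hom' r s :
  in_rel (ssval (translate r)) s -> in_rel (ssval r) (map h' s).
Proof. by rewrite -symbol_ofK; apply: hom_in_rel. Qed.

Lemma hom_reduction : uniformly_reduces (QCSPE_structure B) (QCSPE_structure B').
Proof.
have [gt1|le1] := ltnP 1 #|B'|.
  have [e e_inj] := code_exists B gt1.
  exists (split_sentence tag_translate #|B| e); split.
  - exact: split_polynomial_time.
  - move=> phi; apply: (split_true tag_translate translate_hom translate_hom' e_inj).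
    exact: sentence_wf.
  - by move=> phi; rewrite /= num_blocks_split.
exists (verdict_sentence translate); split.
- exact: check_polynomial_time.
- move=> phi.
  have /card_gt0P[b1 _] := universe_nonempty B'.
  have eq1 (x : B') : x = b1 by apply: (fintype_le1P le1).
  apply: (@verdict_true _ _ _ _ translate h (h' b1)).
  + exact: translate_hom.
  (* Over one element any tuple of a nonempty relation is constant, and [h'] maps it to the constant
     tuple at [h' b1]. *)
  + move=> r /set0Pn[t tr].
    have := @translate_hom' r t; rewrite in_relE tr => /(_ isT).
    have -> // : map h' t = nseq (tag (ssval r)) (h' b1).
    rewrite -tag_translate; transitivity (nseq (size t) (h' b1)); last by rewrite size_tuple.
    by elim: (tval t) => //= x s ->; rewrite (eq1 x).
  + exact: sentence_wf.
- move=> phi; apply: num_blocks_verdict; [exact: tag_translate | exact: sentence_wf].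
Qed.

End Structures.

Theorem mainTheorem14 (sigma : vocabulary) (B B' : structure sigma) :
  hom_equivalent B B' ->
  uniformly_reduces (QCSPE_structure B) (QCSPE_structure B') /\
  uniformly_reduces (QCSPE_structure B') (QCSPE_structure B).
Proof.
case=> -[h hom_h] [h' hom_h'].
by split; [apply: hom_reduction hom_h hom_h' | apply: hom_reduction hom_h' hom_h].
Qed.
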